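(* Let $q$ be a power of an odd prime and let $m\ge 2$ be an integer. Let $S(x)=s_0x+s_1x^q+\cdots+s_{m-1}x^{q^{m-1}}\in\mathbb{F}_{q^m}[x]$ with $s_0s_{m-1}\ne 0$. Then the following are equivalent: (1) the radical of the quadratic form $\mathrm{Tr}(xS(x))$ on $\mathbb{F}_{q^{2m}}$ has dimension $2m-2$ over $\mathbb{F}_q$, and the curve $\mathcal{X}: y^q-y=xS(x)$ is a maximal curve over $\mathbb{F}_{q^{2m}}$; (2) $q\equiv 3\pmod 4$, $m$ is odd, $s_0\in\mathbb{F}_{q^m}\setminus\{0\}$, and for every $1\le i\le m-1$ one has $s_i=0$ if $i$ is odd and $s_i=2s_0^{(q^i+1)/2}$ if $i$ is even.
   Context: $\mathrm{Tr}$ denotes the trace map from $\mathbb{F}_{q^{2m}}$ to $\mathbb{F}_q$. For the quadratic form $Q(x)=\mathrm{Tr}(xS(x))$ from $\mathbb{F}_{q^{2m}}$ to $\mathbb{F}_q$, let $B(x,y)=Q(x+y)-Q(x)-Q(y)$; the radical of $Q$ is the $\mathbb{F}_q$-subspace $W=\{x\in\mathbb{F}_{q^{2m}}: B(x,y)=0\ \text{for all } y\in\mathbb{F}_{q^{2m}}\}$. A curve given by an affine equation $y^q-y=xS(x)$ means the smooth, projective, geometrically irreducible curve with that function field; it has exactly one point at infinity, which is rational, so its number of rational points over a finite field is one plus the number of affine solutions over that field. A curve of genus $g$ defined over $\mathbb{F}_{q^{N}}$ is called maximal over $\mathbb{F}_{q^{N}}$ if its number of $\mathbb{F}_{q^N}$-rational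 points equals $q^N+1+2g\sqrt{q^N}$. *)

(* Defs.v *)
From Stdlib Require Import Classical.
From HB Require Import structures.
From mathcomp Require Import all_boot all_order all_fingroup all_algebra.
From mathcomp Require Import all_solvable all_field.

Set Implicit Arguments.
Unset Strict Implicit.
Unset Printing Implicit Defensive.

Import GRing.Theory Num.Theory.

Local Open Scope ring_scope.

Local Notation "x %:F" := (FracField.tofrac x) : ring_scope.

Definition polar (U V : zmodType) (Q : U -> V) (x y : U) : V :=
  Q (x + y) - Q x - Q y.

Definition radical_dim (K : fieldType) (U : vectType K) (V : zmodType)
    (Q : U -> V) (d : nat) : Prop :=
  exists2 W : {vspace U},
    (forall x, x \in W <-> forall y, polar Q x y = 0) & \dim W = d.

(* The function field of an affine curve y^q - y = f(x) over K, as an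
   extension of K(x) generated by y.  It is unique up to isomorphism when
   y^q - y - f is irreducible over K(x). *)
Record as_curve (K : fieldType) (q : nat) (f : {poly K}) := ASCurve {
  as_field : fieldExtType {fraction {poly K}};
  as_y : as_field;
  as_y_gen : <<1; as_y>>%VS = fullv;
  as_y_eq : as_y ^+ q - as_y = f%:F%:A
}.

Lemma as_curve_exists (K : fieldType) (q : nat) (f : {poly K}) :
  (1 < q)%N -> inhabited (as_curve q f).
Proof.
move=> q_gt1; pose P : {poly {fraction {poly K}}} :=
  'X^q - 'X - f%:F%:P.
have szP : size P = q.+1.
  rewrite /P -addrA size_polyDl size_polyXn // -opprD size_polyN.
  rewrite (leq_ltn_trans (size_polyD _ _)) // gtn_max size_polyX !ltnS q_gt1 /=.
  exact: leq_trans (size_polyC_leq1 _) (ltnW q_gt1).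
have [p irr_p p_dvd] : exists2 p, irreducible_poly p & p %| P.
  have: (1 < size P)%N by rewrite szP ltnS ltnW.
  have [n] := ubnP (size P); elim: n {szP} P => // n IHn R ltRn R_gt1.
  have [irrR | redR] := classic (irreducible_poly R); first by exists R.
  have [d [d_neq1 d_dvd d_neqR]] :
      exists d : {poly {fraction {poly K}}},
        [/\ size d != 1%N, d %| R & ~~ (d %= R)].
    apply: NNPP => noD; apply: redR; split=> // d d1 dR.
    by apply/negPn/negP => dnR; apply: noD; exists d.
  have R0 : R != 0 by rewrite -size_poly_gt0 ltnW.
  have d0 : d != 0 by apply: contraNneq R0 => d0; rewrite d0 dvd0p in d_dvd.
  have ltdR : (size d < size R)%N.
    by rewrite ltn_neqAle dvdp_leq // dvdp_size_eqp // d_neqR.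
  have [||p irr_p p_d] := IHn d.
  - exact: leq_trans ltdR _.
  - by rewrite ltn_neqAle eq_sym d_neq1 size_poly_gt0.
  by exists p => //; apply: dvdp_trans p_d d_dvd.
have [F _ [y Py0 y_gen]] := irredp_FAdjoin irr_p.
split; apply: (@ASCurve K q f F y y_gen).
have: root (map_poly (in_alg F) P) y.
  rewrite -dvdp_XsubCl (dvdp_trans _ (_ : map_poly (in_alg F) p %| _)) //.
    by rewrite dvdp_XsubCl.
  by rewrite dvdp_map.
rewrite /root /P !rmorphB /= map_polyXn map_polyX map_polyC /=.
by rewrite !hornerE subr_eq0 => /eqP.
Qed.

(* For F/K(x) finite, the normalization X of P^1 in F is covered by the affine
   curves x <> oo and x <> 0, whose coordinate rings are the integral closures
   of K[x] and K[1/x] in F; the functions regular on the overlap are those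
   that become integral over K[x] after multiplication by a power of x. *)
Section Genus.

Variables (K : fieldType) (F : fieldExtType {fraction {poly K}}).

Local Notation fracX := (('X : {poly K})%:F).

Definition constF (c : K) : F := c%:P%:F%:A.

Definition regular_fin (z : F) : Prop :=
  integralOver (fun p : {poly K} => p%:F%:A : F) z.

Definition regular_inf (z : F) : Prop :=
  integralOver (fun p : {poly K} => (map_poly constF p).[(fracX^-1)%:A]) z.

Definition regular_overlap (z : F) : Prop :=
  exists n : nat, regular_fin (fracX%:A ^+ n * z).

Definition coboundary (z : F) : Prop :=
  exists a b, [/\ regular_fin a, regular_inf b & z = a + b].

(* The genus of X is dim_K H^1(X, O_X): g is the size of a basis b of the Cech
   cohomology of the cover above. *)
Definition genus_is (g : nat) : Prop :=
  exists b : 'I_g -> F,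
    [/\ forall i, regular_overlap (b i),
        forall z, regular_overlap z ->
          exists c : 'I_g -> K, coboundary (z - \sum_i constF (c i) * b i)
      & forall c : 'I_g -> K,
          coboundary (\sum_i constF (c i) * b i) -> forall i, c i = 0].

End Genus.

(* The single point at infinity plus the affine points over L. *)
Definition as_npoints (k : finFieldType) (L : fieldExtType k) (q : nat)
    (f : {poly L}) : nat :=
  #|[set P : finvect_type L * finvect_type L |
      (P.2 : L) ^+ q - P.2 == f.[P.1]]|.+1.

Definition as_maximal (k : finFieldType) (L : fieldExtType k) (q : nat)
    (f : {poly L}) (X : as_curve q f) : Prop :=
  exists2 g : nat, genus_is (as_field X) g &
    (as_npoints q f)%:R =
      #|finvect_type L|%:R + 1 + 2 * g%:R * sqrtC (#|finvect_type L|%:R) :> algC.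

(* Main.v *)
(* By counting, the number of affine points is q times the number of zeros of
   Q(x) = Tr(x S(x)).  If the radical of Q has codimension 2, comparing with the
   genus q^(m-1)(q-1)/2 shows that the curve is maximal exactly when Q is a
   hyperbolic plane modulo its radical, that is Q(x) = Tr(ax) Tr(bx).  Such an
   identity amounts to the equations s_i = a b^(q^i) + b a^(q^i), 0 < i < m,
   s_0 = a b and a b^(q^m) + b a^(q^m) = 0.  As the s_i are fixed by
   x |-> x^(q^m), the ratio a^(q^m)/a is a square root of -1 moved by that map,
   which yields q = 3 mod 4, m odd, (b/a)^q = - b/a and the formula for s_i.

   The genus of y^q - y = f with n = deg f prime to p is obtained from the
   explicit basis x^-i y^j, q i < n j, of the Cech cohomology.  The functions
   regular over K[x] and K[1/x] are identified with the help of the q-power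
   map: as y^q = y + f, it preserves the K[x]-combinations of 1, y, .., y^(q-1)
   as formal expressions, and the constant term of the q-th power of
   a_0 + a_1 y + .. is a_0^q + a_1^q f + .., whose terms have distinct degrees
   q deg(a_j) + n j. *)

Require Import Defs.
From HB Require Import structures.
From mathcomp Require Import all_boot all_order all_fingroup all_algebra.
From mathcomp Require Import all_solvable all_field.
From mathcomp Require Import zify ring.

Set Implicit Arguments.
Unset Strict Implicit.
Unset Printing Implicit Defensive.

Import GRing.Theory Num.Theory.

Local Open Scope ring_scope.

Local Notation "x %:F" := (FracField.tofrac x) : ring_scope.

(** * Degrees, divisibility and lattice points *)

Lemma size_sum_distinct (R : nzRingType) (I : finType) (P : I -> {poly R}) :
    (forall i j, P i != 0 -> P j != 0 -> size (P i) = size (P j) -> i = j) ->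
  forall i, (size (P i) <= size (\sum_j P j)%R)%N.
Proof.
move=> Pinj i0; pose i := [arg max_(j > i0) size (P j)].
have Pmax j : (size (P j) <= size (P i))%N.
  by rewrite /i; case: arg_maxnP => // k _; apply.
apply: leq_trans (Pmax i0) _; have [->|Pi0] := eqVneq (P i) 0.
  by rewrite size_poly0.
(* The summand of largest size is the only one of that size, so its leading term survives. *)
rewrite (bigD1 i) //= size_polyDl //.
apply: leq_ltn_trans (size_sum _ _ _) _.
rewrite -[X in (_ < X)%N]prednK ?size_poly_gt0 // ltnS.
apply/bigmax_leqP => j neq_ji; rewrite -ltnS prednK ?size_poly_gt0 //.
rewrite ltn_neqAle Pmax andbT; have [->|Pj0] := eqVneq (P j) 0.
  by rewrite size_poly0 eq_sym size_poly_eq0.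
by apply: contra_neq neq_ji => /(Pinj _ _ Pj0 Pi0).
Qed.

(** Once the gcd of [D] and [l] is removed, arbitrarily high powers of the cofactor of [D] divide
    the fixed [H], so that cofactor is a constant: K[x] is completely integrally closed. *)
Lemma dvdp_of_exp_family (K : fieldType) (D H l : {poly K}) (u : nat -> nat) :
    H != 0 -> (forall k, k <= u k)%N ->
    (forall k, D ^+ u k %| H * l ^+ u k) -> D != 0 ->
  D %| l.
Proof.
move=> H0 u_ge dvdD D0; pose g := gcdp D l.
have g0 : g != 0 by rewrite gcdp_eq0 negb_and D0.
have [D' defD] : exists D' : {poly K}, D = D' * g.
  by exists (D %/ g); rewrite divpK ?dvdp_gcdl.
have [l' defl] : exists l' : {poly K}, l = l' * g.
  by exists (l %/ g); rewrite divpK ?dvdp_gcdr.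
have D'0 : D' != 0 by apply: contraNneq D0 => D'0; rewrite defD D'0 mul0r.
have copD'l' : coprimep D' l'.
  have : gcdp (D' * g) (l' * g) %= 1 * g by rewrite -defD -defl mul1r eqpxx.
  by rewrite -(eqp_ltrans (mulp_gcdl _ _ _)) eqp_mul2r // -size_poly_eq1.
have dvdD' k : D' ^+ u k %| H.
  have := dvdD k; rewrite defD defl !exprMn mulrA dvdp_mul2r ?expf_neq0 //.
  by rewrite Gauss_dvdpl // coprimep_expl // coprimep_expr.
have /size_poly1P[c c0 defD'] : size D' == 1%N.
  rewrite eqn_leq size_poly_gt0 D'0 andbT leqNgt; apply/negP => szD'.
  have lt0 : (0 < (size D').-1)%N by rewrite -ltnS prednK // ltnW.
  have /negP[] : ~~ ((size (D' ^+ u (size H))).-1 < size H)%N.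
    by rewrite size_exp -leqNgt (leq_trans (u_ge _)) // leq_pmull.
  rewrite prednK ?(dvdp_leq H0) // size_poly_gt0 expf_neq0 //.
by rewrite defD defD' mul_polyC dvdpZl // dvdp_gcdr.
Qed.

Lemma size_polyB_leq (R : nzRingType) (P Q : {poly R}) s :
  (size P <= s.+1)%N -> (size Q <= s.+1)%N -> P`_s = Q`_s ->
  (size (P - Q)%R <= s)%N.
Proof.
move=> szP szQ eqPQ; apply/leq_sizeP => j; rewrite leq_eqVlt coefB.
case/predU1P => [<-|ltsj]; first by rewrite eqPQ subrr.
by rewrite !nth_default ?subrr // (leq_trans _ ltsj).
Qed.

Lemma coprime_lin_inj n q a b i j : coprime n q -> (i < q)%N -> (j < q)%N ->
  (q * a + n * i)%N = (q * b + n * j)%N -> i = j.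
Proof.
move=> co_nq; wlog le_ij : a b i j / (i <= j)%N => [IH|] ltiq ltjq eq_ab.
  by case/orP: (leq_total i j) => [/IH|/IH H]; [|symmetry]; eauto.
have : (q %| n * (j - i))%N.
  apply/dvdnP; exists (a - b)%N.
  by rewrite mulnBr mulnBl ![(_ * q)%N]mulnC -(subnDl (q * a)%N) eq_ab subnDr.
rewrite Gauss_dvdr 1?coprime_sym // => /dvdn_leq; lia.
Qed.

(** Degree count behind [evaly_eq0]: [d] and [a] stand for the degrees in x of the leading and the
    constant coefficient of a relation, [k] for n times its degree in y. The first inequality gives
    [a <= d], and the second then leaves no room for [k]. *)
Lemma root_degree_eq0 q a d k : (1 < q)%N ->
  (q * a <= d * q.-1 + a)%N -> (q * d + k <= d * q.-1 + a)%N -> k = 0%N.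
Proof.
case: q => // q; rewrite ltnS /= => q0 le1 le2.
have le_ad : (a <= d)%N by rewrite -(leq_pmul2l q0); lia.
by lia.
Qed.

Lemma tofrac_div (R : idomainType) (z : {fraction R}) :
  exists2 d : R, d != 0 & exists a : R, d%:F * z = a%:F.
Proof.
elim/quotW: z => r; exists (frac r).2; first exact: denom_ratioP.
exists (frac r).1; unlock FracField.tofrac.
rewrite -[LHS]FracField.pi_mul; apply/eqmodP; rewrite /= FracField.equivfE.
rewrite /FracField.mulf !numden_Ratio ?mulf_neq0 ?oner_eq0 ?denom_ratioP //.
by rewrite !mul1r !mulr1 mulrC.
Qed.

(** Dividing ['X^t] by the monic equation of [z] leaves a remainder of bounded size, so all powers
    of [z] lie in one finitely generated module. *)
Lemma integral_exp_span (R S : nzRingType) (h : {rmorphism R -> S}) (z : S) :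
    integralOver h z ->
  exists M, forall t, exists2 r : {poly R},
    (size r <= M)%N & z ^+ t = (map_poly h r).[z].
Proof.
case=> r mon_r /eqP rz0; exists (size r) => t.
exists (Pdiv.Ring.rmodp 'X^t r).
  by rewrite ltnW // Pdiv.Ring.ltn_rmodp monic_neq0.
have /(congr1 (fun P => (map_poly h P).[z])) :=
  Pdiv.RingMonic.rdivp_eq mon_r 'X^t.
rewrite map_polyXn hornerXn => ->; rewrite rmorphD rmorphM hornerD.
by rewrite hornerM_comm /comm_poly ?rz0 ?mulr0 ?mul0r ?add0r.
Qed.

(** The half-turn sending (i, j) to (n - i, q - j) exchanges the two sides of the diagonal q i = n
    j, and coprimality keeps lattice points off it. Ordinals start at 0, hence the successors. *)
Lemma card_below_diagonal n q : (0 < n)%N -> (0 < q)%N -> coprime n q ->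
  (#|[set a : 'I_n.-1 * 'I_q.-1 | q * a.1.+1 < n * a.2.+1]|.*2
    = n.-1 * q.-1)%N.
Proof.
move=> n_gt0 q_gt0 co_nq; set A := [set a | _].
pose rv (a : 'I_n.-1 * 'I_q.-1) := (rev_ord a.1, rev_ord a.2).
have rvK : involutive rv by case=> i j; rewrite /rv /= !rev_ordK.
rewrite -addnn -[X in (_ * X)%N]card_ord -[X in (X * _)%N]card_ord.
rewrite -card_prod -(cardsC A); congr (_ + _)%N.
rewrite -(card_imset _ (inv_inj rvK)); apply: eq_card => a.
rewrite -{1}(rvK a) (mem_imset _ _ (inv_inj rvK)) !inE /= -leqNgt.
have lti := ltn_ord a.1; have ltj := ltn_ord a.2.
have -> : (n.-1 - a.1.+1).+1 = (n - a.1.+1)%N by lia.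
have -> : (q.-1 - a.2.+1).+1 = (q - a.2.+1)%N by lia.
have neq : (n * a.2.+1 != q * a.1.+1)%N.
  apply/eqP => eq_nq.
  have : (n %| q * a.1.+1)%N by rewrite -eq_nq dvdn_mulr.
  by rewrite Gauss_dvdr // => /dvdn_leq; lia.
have le1 : (q * a.1.+1 <= q * n)%N by rewrite leq_mul2l; lia.
have le2 : (n * a.2.+1 <= n * q)%N by rewrite leq_mul2l; lia.
rewrite [RHS]leq_eqVlt (negPf neq) /= !mulnBr (mulnC n q) in le2 *.
move: le1 le2; move: (q * _.+1)%N (n * _.+1)%N (q * n)%N => u v w; lia.
Qed.

Lemma integral_exp (R S : comNzRingType) (h : {rmorphism R -> S}) (z : S) i :
  integralOver h z -> integralOver h (z ^+ i).
Proof.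
move=> hz; elim: i => [|i IHi]; first exact: integral1.
by rewrite exprS; apply: integral_mul.
Qed.

(** * Coboundaries and uniqueness of the genus *)

Section Coboundary.

Variables (K : fieldType) (F : fieldExtType {fraction {poly K}}).

(** The structure maps of K[x] and K[1/x] into F from [regular_fin] and [regular_inf], in the form
    of ring morphisms so that the closure properties of [integralOver] apply. *)
Definition fin_morph : {poly K} -> F := in_alg F \o @FracField.tofrac {poly K}.
HB.instance Definition _ := GRing.RMorphism.on fin_morph.

Definition inf_morph : {poly K} -> F :=
  horner_eval (('X : {poly K})%:F^-1)%:A \o map_poly (fin_morph \o polyC).
HB.instance Definition _ := GRing.RMorphism.on inf_morph.

Lemma regular_finE z : regular_fin z = integralOver fin_morph z.
Proof. by []. Qed.

Lemma regular_infE z : regular_inf z = integralOver inf_morph z.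
Proof. by []. Qed.

Lemma constFE k : constF F k = fin_morph k%:P.
Proof. by []. Qed.

Lemma inf_morphC k : inf_morph k%:P = fin_morph k%:P.
Proof. by rewrite /inf_morph /= /horner_eval map_polyC hornerC. Qed.

Lemma regular_fin0 : regular_fin (0 : F).
Proof. by rewrite regular_finE; apply: integral0. Qed.

Lemma regular_inf0 : regular_inf (0 : F).
Proof. by rewrite regular_infE; apply: integral0. Qed.

Lemma coboundaryD (z w : F) :
  coboundary z -> coboundary w -> coboundary (z + w).
Proof.
case=> a [b [a_fin b_inf ->]] [a' [b' [a'_fin b'_inf ->]]].
exists (a + a'), (b + b'); rewrite addrACA.
rewrite ?regular_finE ?regular_infE in a_fin b_inf a'_fin b'_inf *.
by split=> //; apply: integral_add.
Qed.

Lemma coboundaryZ k (z : F) : coboundary z -> coboundary (constF F k * z).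
Proof.
case=> a [b [a_fin b_inf ->]]; exists (constF F k * a), (constF F k * b).
rewrite ?regular_finE ?regular_infE constFE in a_fin b_inf *.
split; last exact: mulrDr.
  by apply: integral_mul => //; apply: integral_id.
by apply: integral_mul => //; rewrite -inf_morphC; apply: integral_id.
Qed.

Lemma coboundary0 : coboundary (0 : F).
Proof.
exists 0, 0; rewrite addr0; split=> //;
  [exact: regular_fin0 | exact: regular_inf0].
Qed.

Lemma coboundary_sum (I : finType) (A : {pred I}) (G : I -> F) :
  (forall i, i \in A -> coboundary (G i)) -> coboundary (\sum_(i in A) G i).
Proof.
by move=> GA; elim/big_ind: _ => //; [exact: coboundary0 | exact: coboundaryD].
Qed.

(** Modulo coboundaries the first basis is expressed in the second by a g by g' matrix; a row vector
    killed by it gives a relation among the first basis, so its rows are free. *)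
Lemma genus_leq g g' : genus_is F g -> genus_is F g' -> (g <= g')%N.
Proof.
case=> b [b_ov _ b_free] [b' [_ b'_span _]].
have [M bM] := fin_all_exists (fun i => b'_span _ (b_ov i)).
pose B := \matrix_(i < g, j < g') M i j.
suff : row_free B.
  by rewrite -row_leq_rank => /leq_trans; apply; apply: rank_leq_col.
rewrite -kermx_eq0; apply/rowV0P => v /sub_kermxP vB0.
suff cob : coboundary (\sum_i constF F (v 0 i) * b i).
  by apply/rowP => i; rewrite mxE; apply: (b_free (fun i => v 0 i)).
have -> : \sum_i constF F (v 0 i) * b i =
    \sum_i constF F (v 0 i) * (b i - \sum_j constF F (M i j) * b' j).
  under [RHS]eq_bigr do rewrite mulrBr.
  rewrite sumrB -[LHS]subr0; congr (_ - _).
  under [RHS]eq_bigr do rewrite mulr_sumr; rewrite exchange_big /=.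
  apply/esym/big1 => j _; under eq_bigr do rewrite mulrA.
  rewrite -mulr_suml; apply/eqP; rewrite mulf_eq0; apply/orP; left.
  under eq_bigr do rewrite !constFE -rmorphM -polyCM.
  rewrite -rmorph_sum -(rmorph_sum polyC) /=.
  have vM : \sum_i v 0 i * M i j = 0.
    have := congr1 (fun u : 'rV_g' => u 0 j) vB0; rewrite !mxE; apply: etrans.
    by apply: eq_bigr => i _; rewrite mxE.
  by rewrite vM !rmorph0.
by apply: coboundary_sum => i _; apply: coboundaryZ.
Qed.

Lemma genus_unique g g' : genus_is F g -> genus_is F g' -> g = g'.
Proof. by move=> gF g'F; apply/anti_leq; rewrite !genus_leq. Qed.

End Coboundary.

(** * The genus of an Artin-Schreier curve *)

Section Genus.

Variables (K : fieldType) (p e q n : nat) (f : {poly K}) (X : as_curve q f).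
Hypotheses (pcharK : p \in [pchar K]) (e_gt0 : (0 < e)%N).
Hypotheses (q_def : q = (p ^ e)%N) (szf : size f = n.+1).
Hypotheses (n_gt0 : (0 < n)%N) (co_np : coprime n p).

Implicit Types (P Q G : {poly {poly K}}) (D r : {poly K}).

Local Notation F := (as_field X).
Local Notation y := (as_y X).

Let p_pr : prime p. Proof. exact: pcharf_prime pcharK. Qed.

Let q_gt1 : (1 < q)%N.
Proof. by rewrite q_def -(exp1n e) ltn_exp2r // prime_gt1. Qed.

Let q_gt0 : (0 < q)%N. Proof. exact: ltnW. Qed.

Let co_nq : coprime n q. Proof. by rewrite q_def coprimeXr. Qed.

Let exprDq (R : comNzRingType) (a b : R) :
  p \in [pchar R] -> (a + b) ^+ q = a ^+ q + b ^+ q.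
Proof.
by move=> pR; rewrite exprDn_pchar // q_def pnatX (eq_pnat _ (pcharf_eq pR))
  pnat_id.
Qed.

Local Notation iota := (fin_morph F).
Local Notation psi := (inf_morph F).

Let iota_inj : injective iota.
Proof. by move=> a b /fmorph_inj /eqP; rewrite tofrac_eq => /eqP. Qed.

Let iota_eq0 a : (iota a == 0) = (a == 0).
Proof. by rewrite -(inj_eq iota_inj) rmorph0. Qed.

Let pcharKx : p \in [pchar {poly K}].
Proof. by rewrite pchar_poly. Qed.

Let pcharF : p \in [pchar F].
Proof. by have := rmorph_pchar iota pcharKx. Qed.

(** * Expressions in y over K[x] and the q-power map *)

Definition evaly : {poly {poly K}} -> F := horner_eval y \o map_poly iota.
HB.instance Definition _ := GRing.RMorphism.on evaly.

Let evX : evaly 'X = y.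
Proof. by rewrite /evaly /= /horner_eval map_polyX hornerX. Qed.

Let evC c : evaly c%:P = iota c.
Proof. by rewrite /evaly /= /horner_eval map_polyC hornerC. Qed.

Let y_expq : y ^+ q = y + iota f.
Proof. by rewrite addrC; apply/eqP; rewrite -subr_eq as_y_eq. Qed.

Let evaly_sum P : evaly P = \sum_(i < size P) iota P`_i * y ^+ i.
Proof.
rewrite -{1}[P]coefK poly_def raddf_sum /=; apply: eq_bigr => i _.
by rewrite -mul_polyC rmorphM rmorphXn /= evC evX.
Qed.

Lemma evaly_reduce P :
  exists2 P' : {poly {poly K}}, (size P' <= q)%N & evaly P = evaly P'.
Proof.
pose A : {poly {poly K}} := 'X^q - ('X + f%:P).
have szX : (size ('X + f%:P : {poly {poly K}})%R < q.+1)%N.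
  by rewrite size_XaddC.
have szA : size A = q.+1 by rewrite size_polyDl size_polyXn // size_polyN.
have mA : A \is monic.
  by rewrite monicE lead_coefDl ?lead_coefXn // size_polyN size_polyXn.
exists (Pdiv.Ring.rmodp P A).
  by rewrite -ltnS -szA Pdiv.Ring.ltn_rmodp monic_neq0.
rewrite {1}[P](Pdiv.RingMonic.rdivp_eq mA) rmorphD rmorphM /=.
rewrite [evaly A](_ : _ = 0) ?mulr0 ?add0r //.
by rewrite rmorphB rmorphD rmorphXn /= evX evC y_expq subrr.
Qed.

(* As y^q = y + f, this represents the q-th power of [evaly P] without raising
   the degree in y. *)
Definition frob_red (P : {poly {poly K}}) : {poly {poly K}} :=
  map_poly (fun a => a ^+ q) P \Po ('X + f%:P).

Let expr0q (R : nzRingType) : 0 ^+ q = 0 :> R.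
Proof. by rewrite expr0n gtn_eqF. Qed.

Let sumXq (R : comNzRingType) (I : finType) (G : I -> R) : p \in [pchar R] ->
  (\sum_i G i) ^+ q = \sum_i G i ^+ q.
Proof.
move=> pR; apply: (big_morph (fun a => a ^+ q)) => [a b|]; first exact: exprDq.
exact: expr0q.
Qed.

Lemma size_frob_red P : size (frob_red P) = size P.
Proof.
rewrite size_comp_poly2 ?size_XaddC //.
have [->|P0] := eqVneq P 0; first by rewrite map_poly0.
by rewrite size_map_poly_id0 // expf_neq0 // lead_coef_eq0.
Qed.

Lemma lead_coef_frob_red P : lead_coef (frob_red P) = lead_coef P ^+ q.
Proof.
rewrite lead_coef_comp ?size_XaddC // lead_coefXaddC expr1n mulr1.
have [->|P0] := eqVneq P 0; first by rewrite map_poly0 lead_coef0 expr0q.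
by rewrite lead_coef_map_id0 ?expr0q // expf_neq0 // lead_coef_eq0.
Qed.

Lemma frob_redE P :
  frob_red P = \sum_(i < size P) (P`_i ^+ q)%:P * ('X + f%:P) ^+ i.
Proof.
have [->|P0] := eqVneq P 0.
  by rewrite /frob_red map_poly0 comp_poly0 size_poly0 big_ord0.
rewrite /frob_red comp_polyE size_map_poly_id0 ?expf_neq0 ?lead_coef_eq0 //.
by apply: eq_bigr => i _; rewrite coef_map_id0 ?expr0q // mul_polyC.
Qed.

Lemma evaly_frob_red P : evaly (frob_red P) = evaly P ^+ q.
Proof.
rewrite [in RHS]evaly_sum sumXq // frob_redE raddf_sum /=.
apply: eq_bigr => i _.
by rewrite rmorphM /= evC !rmorphXn /= rmorphD /= evC evX -y_expq exprMn exprAC.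
Qed.

Lemma coef0_frob_red P : (frob_red P)`_0 = \sum_(i < size P) P`_i ^+ q * f ^+ i.
Proof.
rewrite frob_redE coef_sum; apply: eq_bigr => i _.
by rewrite coefCM; congr (_ * _); rewrite -horner_coef0 !hornerE.
Qed.

Let szXf (a : {poly K}) i : a != 0 ->
  size (a ^+ q * f ^+ i) = (q * (size a).-1 + n * i).+1.
Proof.
move=> a0; have f0 : f != 0 by rewrite -size_poly_eq0 szf.
have sza : (0 < size (a ^+ q))%N by rewrite size_poly_gt0 expf_neq0.
have szfi : (0 < size (f ^+ i))%N by rewrite size_poly_gt0 expf_neq0.
rewrite size_mul ?expf_neq0 // -(prednK sza) -(prednK szfi) !size_exp szf /=.
by rewrite addnS /= mulnC.
Qed.

(** The terms of the constant coefficient have degrees q deg(P_i) + n i, distinct because i < q and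
    n is prime to q; hence the one of largest degree is not cancelled. *)
Lemma size_coef0_frob_red P j : (size P <= q)%N -> P`_j != 0 ->
  (q * (size (P`_j)%R).-1 + n * j < size ((frob_red P)`_0)%R)%N.
Proof.
move=> szP Pj0; have ltj : (j < size P)%N.
  by rewrite ltnNge; apply: contraNN Pj0 => /(nth_default 0) ->.
rewrite coef0_frob_red -szXf //.
apply: (size_sum_distinct (P := fun i : 'I_(size P) => P`_i ^+ q * f ^+ i))
  (Ordinal ltj).
move=> i i'; rewrite !mulf_eq0 !negb_or !expf_eq0 q_gt0 /=.
move=> /andP[Pi0 _] /andP[Pi'0 _]; rewrite !szXf // => -[eq_sz].
apply/val_inj/(coprime_lin_inj co_nq _ _ eq_sz); exact: leq_trans szP.
Qed.

(* A nonzero relation P of least degree satisfies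
   [frob_red P = lead_coef P ^ (q - 1) P]; the degrees of the constant terms
   then contradict [size_coef0_frob_red]. *)
Lemma evaly_eq0 P : (size P <= q)%N -> evaly P = 0 -> P = 0.
Proof.
have [s] := ubnP (size P); elim: s P => // s IHs P ltPs lePq evP0.
have [//|P0] := eqVneq P 0; set l := lead_coef P.
have l0 : l != 0 by rewrite lead_coef_eq0.
have szP : size P = (size P).-1.+1 by rewrite prednK ?size_poly_gt0.
(* Both terms have leading coefficient [l ^+ q] at the same degree in y, so the difference is a
   shorter relation and vanishes by induction. *)
have szR : (size (frob_red P - (l ^+ q.-1)%:P * P)%R <= (size P).-1)%N.
  apply: size_polyB_leq; rewrite -?szP ?size_frob_red //.
    by rewrite mul_polyC size_scale // expf_neq0.
  rewrite -{1}(size_frob_red P) -lead_coefE lead_coef_frob_red coefCM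
    -lead_coefE.
  by rewrite -/l -exprSr prednK.
have frob_redP : frob_red P = (l ^+ q.-1)%:P * P.
  apply/eqP; rewrite -subr_eq0; apply/eqP/IHs.
  - by apply: leq_ltn_trans szR _; rewrite -ltnS -szP.
  - by apply: leq_trans szR _; apply: leq_trans lePq; apply: leq_pred.
  - by rewrite rmorphB rmorphM /= evaly_frob_red evP0 expr0q mulr0 subr0.
have ltd := size_coef0_frob_red lePq l0.
have := ltd; rewrite frob_redP coefCM.
have [->|P00] := eqVneq P`_0 0; first by rewrite mulr0 size_poly0.
have := size_coef0_frob_red lePq P00; rewrite frob_redP coefCM.
rewrite size_mul ?expf_neq0 //.
have szl : (0 < size (l ^+ q.-1))%N by rewrite size_poly_gt0 expf_neq0.
have szP0 : (0 < size (P`_0)%R)%N by rewrite size_poly_gt0.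
have := l0; rewrite -size_poly_gt0 -/l => szl0.
rewrite -(prednK szl) size_exp -{2 3}(prednK szP0) addnS /=.
rewrite muln0 addn0 addSn ltnS -/(lead_coef P) -/l => le1 le2.
(* Now n times the degree in y of [P] is 0, so [P] is a constant in K[x], on which [iota] is
   injective. *)
have := root_degree_eq0 q_gt1 le1 le2.
case/eqP; rewrite muln_eq0 gtn_eqF //= => /eqP szP1.
have defP : P = (P`_0)%:P by apply: size1_polyC; rewrite szP szP1.
have iP0 : iota P`_0 = iota 0 by rewrite -evC -defP evP0 rmorph0.
by rewrite defP (iota_inj iP0).
Qed.

(** * Functions regular over K[x] *)

Let y_integral : integralOver iota y.
Proof.
exists ('X^q - ('X + f%:P)).
  rewrite monicE lead_coefDl ?lead_coefXn // size_polyN size_polyXn.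
  by rewrite size_XaddC.
rewrite rootE -[_.[y]]/(evaly _) rmorphB rmorphD rmorphXn /= evX evC y_expq.
by rewrite subrr.
Qed.

Lemma regular_fin_evaly P : regular_fin (evaly P).
Proof.
rewrite regular_finE -[evaly P]/((map_poly iota P).[y]).
apply: integral_horner y_integral.
by apply/integral_poly => i; rewrite coef_map; apply: integral_id.
Qed.

Lemma evaly_repr z : exists2 D : {poly K}, D != 0 &
  exists2 P : {poly {poly K}}, (size P <= q)%N & iota D * z = evaly P.
Proof.
suff [D D0 [P DzP]] : exists2 D : {poly K}, D != 0 & exists P,
    iota D * z = evaly P.
  by exists D => //; have [P' ? ?] := evaly_reduce P; exists P'; rewrite ?DzP.
have : z \in <<1; y>>%VS by rewrite as_y_gen memvf.
case/Fadjoin_polyP => r /polyOverP r1 ->.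
elim/poly_ind: r r1 => [|r c IHr] r1.
  by exists 1; rewrite ?oner_eq0 //; exists 0; rewrite horner0 mulr0 rmorph0.
have [i|D D0 [P DP]] := IHr.
  by have := r1 i.+1; rewrite coefD coefMX coefC addr0.
have := r1 0%N; rewrite coefD coefMX coefC add0r => /vlineP[k ->].
have [d d0 [a da]] := tofrac_div k.
exists (d * D); first by rewrite mulf_neq0.
exists (d%:P * P * 'X + (D * a)%:P).
rewrite rmorphD !rmorphM /= !evC evX !hornerE mulrDr mulrA -!mulrA.
congr (_ + _).
  by rewrite -DP !mulrA.
rewrite mulrCA; congr (_ * _).
by rewrite /fin_morph /= -da -[RHS]/(in_alg F (d%:F * k)) rmorphM.
Qed.

Let evaly_iter_frob_red k P : evaly (iter k frob_red P) = evaly P ^+ (q ^ k).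
Proof.
elim: k => [|k IHk]; rewrite ?expr1 //=.
by rewrite evaly_frob_red IHk -exprM -expnSr.
Qed.

Let size_iter_frob_red k P : size (iter k frob_red P) = size P.
Proof. by elim: k => //= k IHk; rewrite size_frob_red. Qed.

Let lead_coef_iter_frob_red k P :
  lead_coef (iter k frob_red P) = lead_coef P ^+ (q ^ k).
Proof.
by elim: k => //= k IHk; rewrite lead_coef_frob_red IHk -exprM -expnSr.
Qed.

Let evaly_inj P Q :
  (size P <= q)%N -> (size Q <= q)%N -> evaly P = evaly Q -> P = Q.
Proof.
move=> szP szQ /eqP; rewrite -subr_eq0 -rmorphB => /eqP /evaly_eq0 PQ0.
apply/eqP; rewrite -subr_eq0 PQ0 // (leq_trans (size_polyD _ _)) //.
by rewrite size_polyN geq_max szP.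
Qed.

Let size_CM_leq (a : {poly K}) P :
  (size P <= q)%N -> (size (a%:P * P)%R <= q)%N.
Proof. by rewrite mul_polyC; apply/leq_trans/size_scale_leq. Qed.

(* D^M is a common denominator for all powers of z; it is tested on the leading
   coefficients of the powers z^(q^k). *)
Lemma regular_fin_dvd_lead D P z : D != 0 ->
    (size P <= q)%N -> regular_fin z -> iota D * z = evaly P ->
  D %| lead_coef P.
Proof.
move=> D0 szP; rewrite regular_finE => /integral_exp_span[M zM] DzP.
apply: (@dvdp_of_exp_family _ D (D ^+ M) _ (expn q)) => // [|k|k].
- exact: expf_neq0.
- exact/ltnW/ltn_expl.
(* [D ^+ M] clears every power of [z] at once: such a power is a combination of the z^i with i < M,
   and D^M z^i = D^(M - i) (D z)^i. *)
have [G szG zG] : exists2 G : {poly {poly K}}, (size G <= q)%N &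
    iota (D ^+ M) * z ^+ (q ^ k) = evaly G.
  have [r szr ->] := zM (q ^ k)%N.
  pose G := \sum_(i < size r) (r`_i * D ^+ (M - i))%:P * P ^+ i.
  have [G' szG' GG'] := evaly_reduce G; exists G' => //; rewrite -GG' /G.
  rewrite horner_coef (size_map_inj_poly iota_inj (rmorph0 _)).
  rewrite mulr_sumr rmorph_sum /=; apply: eq_bigr => i _.
  rewrite rmorphM rmorphXn /= evC -DzP exprMn coef_map /= mulrCA mulrA mulrA.
  congr (_ * _); rewrite rmorphM -mulrA; congr (_ * _).
  by rewrite -rmorphXn -rmorphM -exprD subnK // (leq_trans (ltnW (ltn_ord i))).
(* Both sides represent D^M (D z)^(q^k); reduced expressions are unique, so the coefficients at the
   top degree of [P] agree. *)
have eqG : (D ^+ (q ^ k))%:P * G = (D ^+ M)%:P * iter k frob_red P.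
  apply: evaly_inj; rewrite ?size_CM_leq ?size_iter_frob_red //.
  rewrite !rmorphM /= !evC -zG evaly_iter_frob_red -DzP exprMn rmorphXn.
  by rewrite mulrCA.
move: (congr1 (fun Q : {poly {poly K}} => Q`_(size P).-1) eqG).
rewrite !coefCM -{2}(size_iter_frob_red k P) -lead_coefE
  lead_coef_iter_frob_red => <-.
exact: dvdp_mulr.
Qed.

(** Since the denominator [D] divides the leading coefficient, the leading term of [P] divided by
    [D] lies in K[x][y] and can be subtracted from [z]; induction on the degree in y shows that
    K[x][y] is the whole integral closure. *)
Lemma regular_fin_reduced z : regular_fin z ->
  exists2 P : {poly {poly K}}, (size P <= q)%N & z = evaly P.
Proof.
have [D D0 [P szP DzP]] := evaly_repr z.
have [s] := ubnP (size P).
elim: s P z szP DzP => // s IHs P z szP DzP ltPs z_fin.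
have [P0|P0] := eqVneq P 0.
  exists 0; rewrite ?size_poly0 // rmorph0; move/eqP: DzP.
  rewrite P0 rmorph0 mulf_eq0 iota_eq0 (negPf D0).
  by move/eqP ->.
have /dvdpP[/= l lD] := regular_fin_dvd_lead D0 szP z_fin DzP.
have szPS : size P = (size P).-1.+1 by rewrite prednK ?size_poly_gt0.
have [T defT] : {T : {poly {poly K}} | T = l%:P * 'X^((size P).-1)} by eexists.
have szT : (size T <= size P)%N.
  by rewrite defT mul_polyC (leq_trans (size_scale_leq _ _)) // size_polyXn
    -szPS.
have szR : (size (P - D%:P * T)%R <= (size P).-1)%N.
  apply: size_polyB_leq; rewrite -?szPS //.
    by rewrite mul_polyC (leq_trans (size_scale_leq _ _)).
  by rewrite -lead_coefE lD defT !coefCM coefXn eqxx mulr1 mulrC.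
have [] := IHs (P - D%:P * T) (z - evaly T).
- by rewrite (leq_trans szR) // (leq_trans (leq_pred _)).
- by rewrite (rmorphB evaly) mulrBr DzP (rmorphM evaly) /= evC.
- by rewrite (leq_ltn_trans szR) // -ltnS -szPS.
- rewrite regular_finE; apply: integral_sub; rewrite -regular_finE //.
  exact: regular_fin_evaly.
move=> Q szQ zQ; exists (Q + T); last by rewrite rmorphD /= -zQ subrK.
by rewrite (leq_trans (size_polyD _ _)) // geq_max szQ (leq_trans szT).
Qed.

(** * Pole orders at infinity and functions regular over K[1/x] *)

Local Notation x := (iota 'X).
Let x_neq0 : x != 0. Proof. by rewrite iota_eq0 polyX_eq0. Qed.

Let xinvE : (('X : {poly K})%:F^-1)%:A = x^-1 :> F.
Proof. by rewrite -in_algE fmorphV /fin_morph /=. Qed.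

Let psiE r : psi r = \sum_(i < size r) iota (r`_i)%:P * x ^- i.
Proof.
rewrite [LHS](horner_coef_wide _ (size_poly _ _)) xinvE.
by apply: eq_bigr => i _; rewrite coef_map exprVn.
Qed.

Let psi_scaled d r : (size r <= d.+1)%N -> exists2 r' : {poly K},
  (size r' <= d.+1)%N & iota ('X^d) * psi r = iota r'.
Proof.
move=> szr; exists (\sum_(i < size r) (r`_i)%:P * 'X^(d - i)).
  rewrite (leq_trans (size_sum _ _ _)) //; apply/bigmax_leqP => i _.
  rewrite mul_polyC (leq_trans (size_scale_leq _ _)) // size_polyXn ltnS.
  exact: leq_subr.
rewrite psiE mulr_sumr rmorph_sum; apply: eq_bigr => i _.
rewrite rmorphM mulrCA; congr (_ * _); rewrite !rmorphXn /=.
by rewrite expfB_cond // (negPf x_neq0) -ltnS (leq_trans (ltn_ord i)).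
Qed.

(* [inf_order_le C z]: the coefficients of z on the basis 1, y, .., y^(q-1)
   have degree less than C. *)
Definition inf_order_le C z := exists N, exists2 P : {poly {poly K}},
  (size P <= q)%N &
  iota ('X^N) * z = evaly P /\ forall j, (size (P`_j)%R <= N + C)%N.

Let shift_inf_order M C z : inf_order_le C z ->
  exists N, exists2 P : {poly {poly K}}, (size P <= q)%N &
  [/\ (M <= N)%N, iota ('X^N) * z = evaly P
    & forall j, (size (P`_j)%R <= N + C)%N].
Proof.
case=> N [P szP [zP szPj]]; exists (M + N)%N, (('X^M)%:P * P).
  exact: size_CM_leq.
split=> [||j]; first exact: leq_addr.
  by rewrite exprD rmorphM -mulrA zP rmorphM /= evC.
rewrite coefCM; have [->|Pj0] := eqVneq P`_j 0.
  by rewrite mulr0 size_poly0.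
by rewrite mulrC size_mulXn // -addnA leq_add2l.
Qed.

Lemma inf_order_leW C C' z :
  (C <= C')%N -> inf_order_le C z -> inf_order_le C' z.
Proof.
move=> leC [N [P szP [zP szPj]]]; exists N, P => //; split=> // j.
by rewrite (leq_trans (szPj j)) // leq_add2l.
Qed.

Lemma inf_order_leD C z w :
  inf_order_le C z -> inf_order_le C w -> inf_order_le C (z + w).
Proof.
case=> N [P szP [zP szPj]] /(shift_inf_order N)[N' [Q szQ [leN wQ szQj]]].
exists N', (('X^(N' - N))%:P * P + Q).
  by rewrite (leq_trans (size_polyD _ _)) // geq_max szQ size_CM_leq.
split=> [|j].
  rewrite mulrDr wQ -(subnK leN) exprD rmorphM -mulrA zP subnK //.
  by rewrite rmorphD rmorphM /= evC.
rewrite coefD coefCM (leq_trans (size_polyD _ _)) // geq_max szQj andbT.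
have [->|Pj0] := eqVneq P`_j 0; first by rewrite mulr0 size_poly0.
by rewrite mulrC size_mulXn // -{2}(subnK leN) -addnA leq_add2l.
Qed.

Lemma inf_order_le0 C : inf_order_le C 0.
Proof.
exists 0%N, 0; rewrite ?size_poly0 //; split=> [|j].
  by rewrite mulr0 rmorph0.
by rewrite coef0 size_poly0.
Qed.

Lemma inf_order_le_psi C r z : inf_order_le C z -> inf_order_le C (psi r * z).
Proof.
case=> N [P szP [zP szPj]]; have [r' szr' rr'] := psi_scaled (leqnSn (size r)).
exists (size r + N)%N, (r'%:P * P); first exact: size_CM_leq.
split=> [|j]; first by rewrite exprD rmorphM mulrACA rr' zP rmorphM /= evC.
rewrite coefCM (leq_trans (size_polyMleq _ _)) // -addnA.
by have := leq_add szr' (szPj j); lia.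
Qed.

Lemma regular_overlap_exp z i :
  regular_overlap z -> exists C, inf_order_le C (z ^+ i).
Proof.
case=> N /regular_fin_reduced[P _ zP]; have [Q szQ PQ] := evaly_reduce (P ^+ i).
exists (\max_(j < size Q) size (Q`_j)%R), (N * i)%N, Q => //; split=> [|j].
  by rewrite -PQ (rmorphXn evaly) /= -zP exprMn exprM !rmorphXn.
apply: leq_trans (leq_addl _ _); have [ltj|lej] := ltnP j (size Q).
  exact: (leq_bigmax (Ordinal ltj)).
by rewrite nth_default ?size_poly0.
Qed.

Let inf_order_family z M : regular_overlap z ->
  exists C, forall i, (i < M)%N -> inf_order_le C (z ^+ i).
Proof.
move=> z_ov; elim: M => [|M [C IHM]]; first by exists 0%N.
have [C' zM] := regular_overlap_exp M z_ov; exists (maxn C C') => i.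
rewrite ltnS leq_eqVlt => /predU1P[->|/IHM].
  exact: inf_order_leW (leq_maxr _ _) zM.
exact: inf_order_leW (leq_maxl _ _).
Qed.

Let deg_iter_frob_red k P j w : (size P <= q)%N -> P`_j != 0 ->
  w = (q * (size (P`_j)%R).-1 + n * j)%N ->
  (q ^ k * w < size ((iter k.+1 frob_red P)`_0)%R)%N.
Proof.
move=> szP Pj0 ->; elim: k => [|k IHk].
  by rewrite mul1n size_coef0_frob_red.
have szPk : (size (iter k.+1 frob_red P) <= q)%N by rewrite size_iter_frob_red.
have c0 : (iter k.+1 frob_red P)`_0 != 0.
  by rewrite -size_poly_gt0 (leq_ltn_trans _ IHk).
apply: leq_ltn_trans (size_coef0_frob_red szPk c0); rewrite muln0 addn0.
by rewrite expnS -mulnA leq_mul2l -ltnS prednK ?IHk ?orbT // size_poly_gt0.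
Qed.

(* The powers of z have bounded pole order at infinity, whereas each q-th power
   multiplies the weight max_j (q deg P_j + n j) - q N by at least q. *)
Lemma regular_inf_order z N P j : regular_inf z -> (size P <= q)%N ->
    iota ('X^N) * z = evaly P -> P`_j != 0 ->
  (q * (size (P`_j)%R).-1 + n * j <= q * N)%N.
Proof.
move=> z_inf szP zP Pj0; set w := (_ + _)%N.
have z_ov : regular_overlap z.
  by exists N; rewrite -[_ * z]/(iota 'X ^+ N * z) -rmorphXn zP;
    apply: regular_fin_evaly.
move: z_inf; rewrite regular_infE => /integral_exp_span[M zM].
have [C zC] := inf_order_family M z_ov.
(* Every power of [z] is a combination over K[1/x] of the first [M] ones, and coefficients in K[1/x]
   do not raise the order; thus one [C] serves for all powers. *)
have zC' t : inf_order_le C (z ^+ t).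
  have [r szr ->] := zM t; rewrite (horner_coef_wide _ (size_poly _ _)).
  elim/big_ind: _ => [|u v|i _].
  - exact: inf_order_le0.
  - exact: inf_order_leD.
  rewrite coef_map; apply/inf_order_le_psi/zC.
  exact: leq_trans (ltn_ord i) szr.
(* An excess of 1 of [w] over q N becomes at least q^C in the power z^(q^(C+1)), and q^C exceeds
   C. *)
rewrite leqNgt; apply/negP => ltw; pose t := (q ^ C.+1)%N.
have [N' [P' szP' [zP' szP'j]]] := zC' t.
have eqP' : ('X^N')%:P * iter C.+1 frob_red P = ('X^(N * t))%:P * P'.
  apply: evaly_inj; rewrite ?size_CM_leq ?size_iter_frob_red //.
  rewrite !(rmorphM evaly) /= !evC -/(iter C.+1 frob_red P).
  rewrite evaly_iter_frob_red -zP -zP' exprMn.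
  by rewrite mulrCA exprM (rmorphXn iota t).
have ltC := deg_iter_frob_red C szP Pj0 (erefl w).
have := congr1 (fun Q : {poly {poly K}} => size (Q`_0)%R) eqP'; rewrite !coefCM.
have c0 : (iter C.+1 frob_red P)`_0 != 0.
  by rewrite -size_poly_gt0 (leq_ltn_trans _ ltC).
rewrite mulrC size_mulXn //; have := szP'j 0%N.
have [->|P'0] := eqVneq P'`_0 0.
  rewrite mulr0 size_poly0 => _ /eqP; rewrite addn_eq0 size_poly_eq0.
  by rewrite (negPf c0) andbF.
rewrite mulrC size_mulXn // => le1 eq2.
have le3 : (q ^ C * (q * N).+1 <= q ^ C * w)%N by rewrite leq_mul2l ltw orbT.
have := ltn_expl C q_gt1; move: le3; rewrite mulnS mulnA -expnSr -/t mulnC; lia.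
Qed.

Let psiX : psi 'X = x^-1.
Proof. by rewrite /inf_morph /= /horner_eval map_polyX hornerX xinvE. Qed.

Let integral_psi_Vx d : integralOver psi (x ^- d).
Proof.
by rewrite -exprVn -psiX; apply/integral_exp/integral_id.
Qed.

Let integral_psi_scaled d r : (size r <= d.+1)%N ->
  integralOver psi (x ^- d * iota r).
Proof.
move=> szr; rewrite -[r]coefK poly_def rmorph_sum mulr_sumr /=.
elim/big_ind: _ => [|u v|i _]; [exact: integral0 | exact: integral_add |].
rewrite -mul_polyC rmorphM mulrCA; apply: integral_mul.
  by rewrite /= -inf_morphC; apply: integral_id.
have le_id : (i <= d)%N by rewrite -ltnS (leq_trans (ltn_ord i)).
rewrite rmorphXn /= -(subnKC le_id) exprD invfM mulrAC.
by rewrite mulVf ?mul1r ?expf_neq0.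
Qed.

(** The relation y^q = y + f divided by x^(n q) is monic in x^-n y, with coefficients in K[1/x]
    because f has degree n. *)
Let integral_psi_xy : integralOver psi (x ^- n * y).
Proof.
pose c1 := x ^- (n * q.-1); pose c0 := x ^- (n * q.-1) * (x ^- n * iota f).
have c1_int : integralOver psi c1 by apply: integral_psi_Vx.
have c0_int : integralOver psi c0.
  by apply: integral_mul => //; apply: integral_psi_scaled; rewrite szf.
have sz1 : (size (c1 *: 'X + c0%:P)%R < q.+1)%N.
  rewrite (leq_ltn_trans (size_polyD _ _)) // gtn_max ltnS.
  rewrite (leq_trans (size_scale_leq _ _)) ?size_polyX //=.
  exact: leq_ltn_trans (size_polyC_leq1 _) _.
apply: (@integral_root_monic _ _ psi _ ('X^q - (c1 *: 'X + c0%:P))).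
- by rewrite monicE lead_coefDl ?lead_coefXn // size_polyN size_polyXn.
- have xq : (x ^- n) ^+ q = x ^- (n * q.-1) * x ^- n.
    by rewrite -invfM -exprD -mulnSr prednK // exprVn -exprM.
  by rewrite rootE !hornerE subr_eq0 exprMn y_expq xq /c1 /c0 mulrDr !mulrA.
apply/integral_poly => i; rewrite coefB coefD coefZ coefC coefX coefXn.
apply: integral_sub; first exact: integral_nat.
apply: integral_add; first by apply: integral_mul => //; apply: integral_nat.
by case: ifP => // _; apply: integral0.
Qed.

(** Replacing y^q by y + f turns the q-th power into x^-(q i - n j) (x^-n y + x^-n f)^j, which is
    integral; a q-th root of an integral element is integral. *)
Lemma regular_inf_monomial i j : (n * j <= q * i)%N ->
  regular_inf (x ^- i * y ^+ j).
Proof.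
move=> le_nj; rewrite regular_infE; set w := _ * _.
have wq : integralOver psi (w ^+ q).
  have -> : w ^+ q = x ^- (q * i - n * j) * (x ^- n * y + x ^- n * iota f) ^+ j.
    rewrite -mulrDr -y_expq exprMn /w exprMn -!exprM [(j * q)%N]mulnC mulrA.
    by rewrite -!exprVn -!exprM -exprD subnK // mulnC.
  apply: integral_mul; first exact: integral_psi_Vx.
  apply/integral_exp/integral_add; first exact: integral_psi_xy.
  by apply: integral_psi_scaled; rewrite szf.
apply: (@integral_root_monic _ _ psi _ ('X^q - (w ^+ q)%:P)).
- rewrite monicE lead_coefDl ?lead_coefXn // size_polyN size_polyXn.
  exact: leq_ltn_trans (size_polyC_leq1 _) _.
- by rewrite rootE !hornerE subrr.
apply/integral_poly => k; rewrite coefB coefC coefXn.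
apply: integral_sub; first exact: integral_nat.
by case: ifP => // _; apply: integral0.
Qed.

(** * A monomial basis of the Cech cohomology *)

Let A := [set a : 'I_n.-1 * 'I_q.-1 | (q * a.1.+1 < n * a.2.+1)%N].
(** Exponents are the ordinals shifted by one: [A] gives the monomials x^-i y^j with 0 < i < n, 0 <
    j < q and q i < n j. *)
Let mono (a : 'I_n.-1 * 'I_q.-1) : F := x ^- a.1.+1 * y ^+ a.2.+1.

Let spanned z := exists c : 'I_n.-1 * 'I_q.-1 -> K,
  coboundary (z - \sum_(a in A) constF F (c a) * mono a).

Let spanned_coboundary z : coboundary z -> spanned z.
Proof.
move=> z_cob; exists (fun=> 0); rewrite big1 ?subr0 // => a _.
by rewrite -[constF _ _]/(iota 0%:P) rmorph0 mul0r.
Qed.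

Let spannedD z w : spanned z -> spanned w -> spanned (z + w).
Proof.
case=> c zc [d wd]; exists (fun a => c a + d a).
have := coboundaryD zc wd; rewrite addrACA -opprD -big_split /=.
under eq_bigr do rewrite -mulrDl -[constF _ _ + _]/(iota _%:P + iota _%:P).
under [in X in _ -> X]eq_bigr do rewrite -[constF _ _]/(iota _%:P) polyCD
  rmorphD.
by [].
Qed.

(** If n j <= q i the monomial is regular at infinity, and if i = 0 it is regular over K[x]. In the
    remaining case q i < n j and j < q force 0 < i < n and 0 < j, so it belongs to the basis. *)
Let spanned_monomial k i j :
  (j < q)%N -> spanned (constF F k * (x ^- i * y ^+ j)).
Proof.
move=> ltjq; have [le_nj|lt_nj] := leqP (n * j) (q * i).
  apply/spanned_coboundary/coboundaryZ; exists 0, (x ^- i * y ^+ j).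
  rewrite add0r; split=> //; last exact: regular_inf_monomial.
  exact: regular_fin0.
case: i lt_nj => [|i] lt_nj.
  rewrite expr0 invr1 mul1r; apply/spanned_coboundary/coboundaryZ.
  exists (y ^+ j), 0; rewrite addr0; split=> //; last exact: regular_inf0.
  by rewrite regular_finE; apply: integral_exp.
case: j ltjq lt_nj => [|j] ltjq lt_nj; first by rewrite muln0 in lt_nj.
have ltin : (i < n.-1)%N.
  rewrite -ltnS prednK // -(ltn_pmul2l q_gt0) (leq_trans lt_nj) // mulnC.
  by rewrite leq_mul2r ltnW ?orbT.
have ltj : (j < q.-1)%N by rewrite -ltnS prednK.
pose a := (Ordinal ltin, Ordinal ltj).
exists (fun b => if b == a then k else 0).
rewrite (bigD1 a) ?inE //= eqxx big1 ?addr0 ?subrr; first exact: coboundary0.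
move=> b /andP[_ /negPf ->].
by rewrite -[constF _ _]/(iota 0%:P) rmorph0 mul0r.
Qed.

Let overlap_spanned z : regular_overlap z -> spanned z.
Proof.
case=> N /regular_fin_reduced[P szP zP].
have {zP} -> : z = x ^- N * evaly P.
  by rewrite -zP -[_ * z]/(x ^+ N * z) mulKf // expf_neq0.
have sp0 : spanned 0 by apply/spanned_coboundary/coboundary0.
rewrite evaly_sum mulr_sumr.
elim/big_ind: _ => [||j _]; [exact: sp0 | exact: spannedD |].
rewrite -[P`_j]coefK poly_def rmorph_sum mulr_suml mulr_sumr /=.
elim/big_ind: _ => [||l _]; [exact: sp0 | exact: spannedD |].
have ltjq : (j < q)%N := leq_trans (ltn_ord j) szP.
rewrite -mul_polyC rmorphM rmorphXn /= -mulrA mulrCA [x ^- N * _]mulrA.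
have [leNl|ltlN] := leqP N l; last first.
  have -> : x ^- N * x ^+ l = x ^- (N - l).
    by rewrite expfB_cond ?(negPf x_neq0) ?(ltnW ltlN) // invf_div mulrC.
  exact: spanned_monomial.
apply/spanned_coboundary/coboundaryZ.
exists (x ^- N * x ^+ l * y ^+ j), 0; rewrite addr0; split=> //.
  rewrite [x ^- N * _]mulrC -expfB_cond ?(negPf x_neq0) //.
  rewrite regular_finE; apply: integral_mul; apply: integral_exp => //.
  exact: integral_id.
exact: regular_inf0.
Qed.

(** In x^n w the term x^n z only has x-degrees at least n, so each c survives as the coefficient of
    x^(n - i) y^j. Were it nonzero, [regular_inf_order] would give n j <= q i, against membership in
    [A]. *)
Let mono_free c : coboundary (\sum_(a in A) constF F (c a) * mono a) ->
  forall a, a \in A -> c a = 0.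
Proof.
case=> z [w [z_fin w_inf sum_zw]] a; rewrite inE => aA.
have [P szP zP] := regular_fin_reduced z_fin.
pose T (b : 'I_n.-1 * 'I_q.-1) : {poly {poly K}} :=
  ((c b)%:P * 'X^(n - b.1.+1))%:P * 'X^(b.2.+1).
pose Q : {poly {poly K}} := \sum_(b in A) T b - ('X^n)%:P * P.
have szQ : (size Q <= q)%N.
  rewrite (leq_trans (size_polyD _ _)) // size_polyN geq_max size_CM_leq //
    andbT.
  rewrite (leq_trans (size_sum _ _ _)) //; apply/bigmax_leqP => b _.
  rewrite /T mul_polyC (leq_trans (size_scale_leq _ _)) // size_polyXn.
  by rewrite -ltn_predRL.
have wQ : iota ('X^n) * w = evaly Q.
  rewrite /Q (rmorphB evaly) (rmorphM evaly) /= evC -zP.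
  have -> : w = \sum_(a in A) constF F (c a) * mono a - z.
    by rewrite sum_zw addrC addKr.
  rewrite mulrBr; congr (_ - _); rewrite mulr_sumr rmorph_sum /=.
  apply: eq_bigr => b _; rewrite /T !(rmorphM evaly) !rmorphXn /=.
  rewrite evC evX rmorphM rmorphXn.
  rewrite mulrCA /mono mulrA -!mulrA; congr (_ * _).
  rewrite mulrA; congr (_ * _).
  by rewrite expfB_cond ?(negPf x_neq0) //; have := ltn_ord b.1; lia.
have cQ : (Q`_(a.2.+1))`_(n - a.1.+1) = c a.
  have ltan := ltn_ord a.1.
  rewrite /Q coefB coefCM coefB coefXnM ifT ?subr0; last by lia.
  rewrite coef_sum coef_sum (bigD1 a) ?inE //= big1 ?addr0.
    by rewrite coefCM coefXn eqxx mulr1 coefCM coefXn eqxx mulr1.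
  move=> b /andP[_ neq_ba]; rewrite coefCM coefXn eqSS.
  have [eq2|_] := eqVneq (a.2 : nat) b.2; last by rewrite mulr0 coef0.
  rewrite mulr1 coefCM coefXn; case: eqP => [eq1|]; last by rewrite mulr0.
  case/negP: neq_ba; rewrite -pair_eqE /pair_eq -!val_eqE /= eq2 eqxx andbT.
  have ltn1 (b' : 'I_n.-1) : (b' < n)%N := leq_trans (ltn_ord b') (leq_pred n).
  by have /eqP := congr1 (subn n) eq1; rewrite !subKn // eqSS eq_sym.
apply/eqP/negPn/negP => ca0.
have Qj0 : Q`_(a.2.+1) != 0.
  by apply: contraNneq ca0 => Qj; rewrite -cQ Qj coef0.
have := regular_inf_order w_inf szQ wQ Qj0; apply/negP; rewrite -ltnNge.
have ltsz : (n - a.1.+1 < size (Q`_(a.2.+1))%R)%N.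
  by rewrite ltnNge; apply: contraNN ca0 => /(nth_default 0); rewrite -cQ => ->.
have le1 : (q * (n - a.1.+1) <= q * (size (Q`_(a.2.+1))%R).-1)%N.
  by rewrite leq_mul2l -ltnS prednK ?(leq_ltn_trans _ ltsz) ?ltsz ?orbT.
rewrite mulnBr leq_subLR addnC in le1.
by apply: leq_ltn_trans le1 _; rewrite ltn_add2l.
Qed.

Lemma artin_schreier_genus_card : genus_is F #|A|.
Proof.
exists (fun k => mono (enum_val k)); split=> [k|z z_ov|c].
- set a := enum_val k; exists a.1.+1; rewrite /mono mulrA.
  rewrite -[_ ^+ _ / _]/(x ^+ _ / x ^+ _) divff ?expf_neq0 // mul1r.
  by rewrite regular_finE; apply: integral_exp.
- have [c zc] := overlap_spanned z_ov; exists (fun k => c (enum_val k)).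
  by rewrite -(big_enum_val (fun a => constF F (c a) * mono a)).
move=> c_cob k; pose c' a := c (enum_rank_in (enum_valP k) a).
have cE i : c i = c' (enum_val i) by rewrite /c' enum_valK_in.
rewrite cE; apply: mono_free (enum_valP k).
rewrite (big_enum_val (fun a => constF F (c' a) * mono a)).
by under eq_bigr do rewrite -cE.
Qed.

Lemma artin_schreier_genus g :
  genus_is F g <-> (g.*2 = n.-1 * q.-1)%N.
Proof.
have A2 : (#|A|.*2 = n.-1 * q.-1)%N by rewrite card_below_diagonal.
split=> [gF|]; first by rewrite (genus_unique gF artin_schreier_genus_card).
by rewrite -A2 => /double_inj ->; apply: artin_schreier_genus_card.
Qed.

End Genus.

(** * Trace forms over a finite field *)

Lemma sum_cycle (gT : finGroupType) (V : nmodType) (a : gT) (F : gT -> V) :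
  \sum_(x in <[a]>%g) F x = \sum_(i < #[a]%g) F (a ^+ i)%g.
Proof.
have inj : {in predT &, injective (fun i : 'I_#[a]%g => (a ^+ i)%g)}.
  move=> i j _ _ /= /eqP; rewrite eq_expg_mod_order !modn_small // => /eqP.
  exact: val_inj.
rewrite -(big_imset F inj) /=; apply: eq_bigl => x; apply/idP/imsetP.
  by case/cyclePmin => i lti ->; exists (Ordinal lti).
by case=> i _ ->; apply: mem_cycle.
Qed.

Section TraceForm.

Variables (p e q : nat) (Fq : finFieldType) (L : splittingFieldType Fq).
Hypotheses (p_prime : prime p) (p_odd : odd p) (e_gt0 : (0 < e)%N).
Hypotheses (q_def : q = (p ^ e)%N) (card_Fq : #|Fq| = q).

Local Notation N := (\dim {:L}).
Local Notation Tr := (galTrace 1 {:L}).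

Let pcharFq : p \in [pchar Fq].
Proof. by apply: (card_finPcharP (n := e)); rewrite // card_Fq. Qed.

Let pcharL : p \in [pchar L].
Proof. exact: (rmorph_pchar (in_alg L)). Qed.

Let q_odd : odd q. Proof. by rewrite q_def oddX p_odd orbT. Qed.

Let q_gt1 : (1 < q)%N.
Proof. by rewrite q_def -(exp1n e) ltn_exp2r // prime_gt1. Qed.

Let q_gt0 : (0 < q)%N. Proof. exact: ltnW. Qed.

Let two_neq0 : 2%:R != 0 :> L.
Proof.
rewrite -(dvdn_pcharf pcharL) dvdn_prime2 //.
by apply: contraL p_odd => /eqP ->.
Qed.

Let N_gt0 : (0 < N)%N.
Proof. by have := dimvS (sub1v {:L}%AS); rewrite dimv1. Qed.

Let exprDq k (x y : L) : (x + y) ^+ (q ^ k) = x ^+ (q ^ k) + y ^+ (q ^ k).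
Proof.
by rewrite exprDn_pchar // q_def -expnM pnatX (eq_pnat _ (pcharf_eq pcharL))
  pnat_id.
Qed.

Let exprNq k (x : L) : (- x) ^+ (q ^ k) = - x ^+ (q ^ k).
Proof. by rewrite exprNn -signr_odd oddX q_odd orbT expr1 mulN1r. Qed.

Lemma mem_subfield_exp (K : {subfield L}) x :
  (x \in K) = (x ^+ (q ^ \dim K) == x).
Proof. by rewrite Fermat's_little_theorem card_Fq. Qed.

Lemma exp_card (x : L) : x ^+ (q ^ N) = x.
Proof. by apply/eqP; rewrite -mem_subfield_exp memvf. Qed.

Lemma mem1_exp (x : L) : (x \in 1%VS) = (x ^+ q == x).
Proof. by rewrite (mem_subfield_exp 1%AS) dimv1 expn1. Qed.

Lemma galTrace_sum (x : L) : Tr x = \sum_(k < N) x ^+ (q ^ k).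
Proof.
have [alpha gen_a alphaE] := finField_galois_generator (sub1v {:L}%AS).
rewrite dimv1 expn1 card_Fq in alphaE; move/eqP in gen_a.
rewrite /galTrace gen_a sum_cycle.
have -> : #[alpha]%g = N.
  rewrite orderE -gen_a -galois_dim ?dimv1 ?divn1 //.
  exact: finField_galois (sub1v _).
apply: eq_bigr => k _; elim: (k : nat) => [|i IHi]; first by rewrite gal_id.
by rewrite expgSr galM ?memvf // IHi alphaE ?memvf // -exprM -expnSr.
Qed.

Lemma galTrace_exp k (x : L) : Tr (x ^+ (q ^ k)) = Tr x.
Proof.
elim: k => [|k IHk]; first by rewrite expr1.
rewrite expnSr exprM -[RHS]IHk !galTrace_sum; move: (x ^+ _) => z {IHk x}.
case: N N_gt0 (exp_card z) => // M _ zq; rewrite big_ord_recr big_ord_recl /=.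
rewrite addrC -exprM -expnS zq expn0 expr1; congr (_ + _).
by apply: eq_bigr => i _; rewrite -exprM -expnS.
Qed.

Lemma galTrace_mem (x : L) : Tr x \in 1%VS.
Proof. by apply: mem_galTrace (memvf x); apply: finField_galois (sub1v _). Qed.

Lemma galTrace_linear : linear Tr.
Proof.
move=> c x y; rewrite raddfD; congr (_ + _); rewrite /galTrace scaler_sumr.
by apply: eq_bigr => g _; rewrite linearZ.
Qed.

Lemma galTraceMl (c x : L) : c \in 1%VS -> Tr (c * x) = c * Tr x.
Proof.
case/vlineP => k ->; rewrite -!scalerAl !mul1r.
by have := galTrace_linear k x 0; rewrite raddf0 !addr0.
Qed.

Lemma card_finvspace (V : {vspace L}) :
  #|[set x : finvect_type L | x \in V]| = (q ^ \dim V)%N.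
Proof.
rewrite -card_Fq -[RHS](@card_vspace Fq (finvect_type L) _ V).
by apply: eq_card => x; rewrite inE.
Qed.

Lemma card_finvect : #|finvect_type L| = (q ^ N)%N.
Proof.
rewrite -card_finvspace -cardsT; apply: eq_card => x; rewrite !inE.
by rewrite (memvf (x : L)).
Qed.

(** A polynomial of degree less than q^N that vanishes on all q^N elements of L is zero. *)
Lemma q_poly_eq0 (d : nat -> L) :
    (forall x : L, \sum_(k < N) d k * x ^+ (q ^ k) = 0) ->
  forall k, (k < N)%N -> d k = 0.
Proof.
move=> d0 k ltkN; pose P : {poly L} := \sum_(i < N) d i *: 'X^(q ^ i).
have szP : (size P <= q ^ N)%N.
  rewrite (leq_trans (size_sum _ _ _)) //; apply/bigmax_leqP => i _.
  by rewrite (leq_trans (size_scale_leq _ _)) // size_polyXn ltn_exp2l.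
have szE : size (enum (finvect_type L)) = (q ^ N)%N.
  by rewrite -cardE card_finvect.
have P0 : P = 0.
  apply/eqP/contraT => P_neq0.
  have rP : all (root P) (enum (finvect_type L) : seq L).
    apply/allP => x _; rewrite rootE horner_sum -[X in _ == X](d0 x).
    by apply/eqP; apply: eq_bigr => i _; rewrite hornerZ hornerXn.
  have := max_poly_roots P_neq0 rP (enum_uniq (finvect_type L)).
  by rewrite szE ltnNge szP.
have := congr1 (fun Q : {poly L} => Q`_(q ^ k)) P0; rewrite coef0 coef_sum.
rewrite (bigD1 (Ordinal ltkN)) //= coefZ coefXn eqxx mulr1 big1 ?addr0 // => i.
by rewrite -val_eqE /= coefZ coefXn eq_sym eqn_exp2l // => /negPf ->;
  rewrite mulr0.
Qed.

Lemma galTrace_nondegenerate (a : L) : (forall y, Tr (y * a) = 0) -> a = 0.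
Proof.
move=> Tr0; apply/eqP/contraT => a0.
suff /eqP : (1 : L) = 0 by rewrite oner_eq0.
apply: (@q_poly_eq0 (fun=> 1) _ 0%N N_gt0) => x.
under eq_bigr do rewrite mul1r.
by rewrite -galTrace_sum -[x](divfK a0) Tr0.
Qed.

Lemma galTrace_eq1 : exists z : L, Tr z = 1.
Proof.
have /(@existsP (finvect_type L))[z Trz] :
    [exists z : finvect_type L, Tr z != 0].
  rewrite -negb_forall; apply/negP => /forallP Tr0.
  suff /eqP : (1 : L) = 0 by rewrite oner_eq0.
  by apply: galTrace_nondegenerate => z; rewrite mulr1; apply/eqP/Tr0.
by exists ((Tr z)^-1 * z); rewrite galTraceMl ?memvV ?galTrace_mem ?mulVf.
Qed.

Lemma dim_lt_add_line (U : {vspace L}) x :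
  x \notin U -> (\dim U < \dim (U + <[x]>))%N.
Proof.
move=> xU; rewrite ltnNge (geq_leqif (dimv_leqif_sup (addvSl U <[x]>%VS))).
by rewrite subv_add subvv -memvE.
Qed.

Let exp_base (k : Fq) i : k ^+ (q ^ i) = k.
Proof. by elim: i => // i IHi; rewrite expnS exprM -{1}card_Fq expf_card. Qed.

Lemma frobenius_anti (t : L) k : t ^+ q = - t -> t ^+ (q ^ k) = (-1) ^+ k * t.
Proof.
move=> tq; elim: k => [|k IHk]; first by rewrite expr1 mul1r.
have signq : ((-1) ^+ k) ^+ q = (-1) ^+ k :> L.
  by rewrite -exprM -signr_odd oddM q_odd andbT signr_odd.
by rewrite expnSr exprM IHk exprMn tq signq exprS mulN1r mulrN mulNr.
Qed.

(** Here t^(q - 1) = -1, and (q^k + 1) / 2 - 1 = (q^k - 1) / 2 is an even multiple of q - 1: for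
    even k, q^2 - 1 divides q^k - 1, and 4 divides q + 1. *)
Lemma exp_half_anti (t : L) k : (q %% 4 = 3)%N -> t ^+ q = - t -> t != 0 ->
  ~~ odd k -> t ^+ ((q ^ k + 1) %/ 2)%N = t.
Proof.
move=> q3 tq t0 k_even; have tq1 : t ^+ q.-1 = -1.
  by apply: (mulIf t0); rewrite -exprSr prednK // tq mulN1r.
have [c ->] : exists c, ((q ^ k + 1) %/ 2 = 1 + q.-1 * (2 * c))%N.
  have [l ->] : exists l, k = (2 * l)%N.
    by exists k./2; rewrite mul2n even_halfK.
  have /dvdnP[j jE] := dvdn_pred_predX (q ^ 2) l.
  have [d dE] : exists d, (q.+1 = 4 * d)%N.
    by exists (q %/ 4).+1; rewrite {1}(divn_eq q 4) q3; lia.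
  have q2 : ((q ^ 2).-1 = q.-1 * (4 * d))%N.
    by rewrite -dE -{1}(prednK q_gt0) expnS expn1 -{3}(prednK q_gt0); lia.
  exists (j * d)%N; rewrite expnM.
  have -> : ((q ^ 2) ^ l + 1 = (1 + q.-1 * (2 * (j * d))) * 2)%N.
    rewrite -(@prednK ((q ^ 2) ^ l)) ?expn_gt0 ?q_gt0 // jE q2; lia.
  by rewrite mulnK.
by rewrite exprD expr1 exprM tq1 exprM -signr_odd expr1n mulr1.
Qed.

(** * Hyperplanes cut out by traces *)

Definition trace_mul (a x : L) : L := Tr (x * a).

Lemma trace_mul_linear a : linear (trace_mul a).
Proof.
by move=> c x y; rewrite /trace_mul mulrDl -scalerAl galTrace_linear.
Qed.

HB.instance Definition _ a :=
  GRing.isLinear.Build Fq L L *:%R (trace_mul a) (trace_mul_linear a).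

Definition trace_ker (a : L) : {vspace L} := lker (linfun (trace_mul a)).

Lemma mem_trace_ker a x : (x \in trace_ker a) = (Tr (x * a) == 0).
Proof. by rewrite memv_ker lfunE. Qed.

Lemma dim_trace_ker a : a != 0 -> (\dim (trace_ker a)).+1 = N.
Proof.
move=> a0; suff limE : limg (linfun (trace_mul a)) = 1%VS.
  by rewrite -(limg_ker_dim (linfun (trace_mul a)) fullv) capfv limE dimv1
    addn1.
apply/eqP; rewrite eqEsubv; apply/andP; split.
  by apply/subvP => _ /memv_imgP[x _ ->]; rewrite lfunE /= galTrace_mem.
have [z Trz] := galTrace_eq1; rewrite -memvE; apply/memv_imgP.
by exists (z / a); rewrite ?memvf // lfunE /= /trace_mul divfK.
Qed.

Lemma anti_notin1 (t : L) : t != 0 -> t ^+ q = - t -> t \notin 1%VS.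
Proof.
move=> t0 tq; rewrite mem1_exp tq; apply: contraNN t0.
by rewrite eq_sym -addr_eq0 -mulr2n -mulr_natl mulf_eq0 (negPf two_neq0).
Qed.

Lemma dim_cap_trace_ker (a t : L) : a != 0 -> t != 0 -> t ^+ q = - t ->
  (\dim (trace_ker a :&: trace_ker (t * a))).+2 = N.
Proof.
move=> a0 t0 tq; have b0 : t * a != 0 by rewrite mulf_neq0.
(* Inclusion of the kernels would make the second form a multiple of the first by a constant [c] of
   F_q, read off at z / a where the first form is 1; then t = c, against t^q = -t. *)
have nsub : ~~ (trace_ker a <= trace_ker (t * a))%VS.
  apply/negP => /subvP sub; have [z Trz] := galTrace_eq1.
  pose c := Tr (z / a * (t * a)).
  case/negP: (anti_notin1 t0 tq); suff -> : t = c by apply: galTrace_mem.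
  apply/eqP; rewrite -subr_eq0 -(mulIr_eq0 _ (mulIf a0)); apply/eqP.
  apply: galTrace_nondegenerate => x.
  have /sub : x - Tr (x * a) * (z / a) \in trace_ker a.
    rewrite mem_trace_ker mulrBl raddfB /= -mulrA divfK //.
    rewrite [Tr (_ * z)]galTraceMl ?galTrace_mem //.
    by rewrite Trz mulr1 subrr.
  rewrite mem_trace_ker mulrBl raddfB /= -mulrA.
  rewrite [Tr (Tr _ * _)]galTraceMl ?galTrace_mem // => /eqP eq0.
  rewrite mulrBl mulrBr raddfB /= [x * (c * a)]mulrCA.
  rewrite [Tr (c * _)]galTraceMl ?galTrace_mem //.
  by rewrite [c * _]mulrC.
have lt : (\dim (trace_ker (t * a)) < \dim (trace_ker a + trace_ker (t * a)))%N.
  rewrite ltnNge (geq_leqif (dimv_leqif_sup (addvSr _ _))).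
  by rewrite subv_add (negPf nsub).
have := dimv_sum_cap (trace_ker a) (trace_ker (t * a)).
have := dimvS (subvf (trace_ker a + trace_ker (t * a))).
have := dim_trace_ker a0; have := dim_trace_ker b0; move: lt; lia.
Qed.

(** Inclusion and exclusion for two hyperplanes meeting in codimension 2. *)
Lemma card_zeros (a t : L) : a != 0 -> t != 0 -> t ^+ q = - t ->
  (#|[set x : finvect_type L | ((Tr (x * a) * Tr (x * (t * a))) == 0)%R]|
     + q ^ N.-2 = 2 * q ^ N.-1)%N.
Proof.
move=> a0 t0 tq; have b0 : t * a != 0 by rewrite mulf_neq0.
pose U (V : {vspace L}) := [set x : finvect_type L | (x : L) \in V].
have -> : [set x : finvect_type L | Tr (x * a) * Tr (x * (t * a)) == 0] =
    U (trace_ker a) :|: U (trace_ker (t * a)).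
  by apply/setP => x; rewrite !inE !mem_trace_ker mulf_eq0.
have <- : #|U (trace_ker a) :&: U (trace_ker (t * a))| = (q ^ N.-2)%N.
  rewrite -(dim_cap_trace_ker a0 t0 tq) /= -card_finvspace; apply: eq_card => x.
  by rewrite !inE memv_cap.
rewrite cardsU subnK; last first.
  by apply: leq_trans (subset_leq_card (subsetIl _ _)) (leq_addr _ _).
rewrite !card_finvspace mul2n -addnn.
by rewrite -{1}(dim_trace_ker a0) -(dim_trace_ker b0).
Qed.

(** * The Artin-Schreier map and the number of affine points *)

Definition as_map (x : L) : L := x ^+ q - x.

Lemma as_map_linear : linear as_map.
Proof.
move=> c x y; have := exprDq 1 (c *: x) y; rewrite !expn1 /as_map => ->.
have := exp_base c 1; rewrite expn1 exprZn => ->.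
by rewrite scalerBr opprD addrACA.
Qed.

HB.instance Definition _ := GRing.isLinear.Build Fq L L *:%R as_map
  as_map_linear.

(** Additive Hilbert 90: the trace is invariant under the q-power map, and the kernel F_q of
    [as_map] makes the dimensions agree. *)
Lemma limg_as_map : limg (linfun as_map) = trace_ker 1.
Proof.
have sub : (limg (linfun as_map) <= trace_ker 1)%VS.
  apply/subvP => _ /memv_imgP[x _ ->].
  rewrite mem_trace_ker lfunE /= mulr1 raddfB /=.
  by have := galTrace_exp 1 x; rewrite expn1 => ->; rewrite subrr.
apply/eqP; rewrite eqEdim sub /=.
have := limg_ker_dim (linfun as_map) fullv; rewrite capfv.
have -> : lker (linfun as_map) = 1%VS.
  by apply/vspaceP => x; rewrite memv_ker lfunE /= subr_eq0 mem1_exp.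
by rewrite dimv1 add1n -(dim_trace_ker (oner_neq0 L)) => -[->].
Qed.

Lemma card_as_map_fiber (z : L) :
  #|[set y : finvect_type L | (y : L) ^+ q - y == z]| =
  if Tr z == 0 then q else 0%N.
Proof.
have -> : (Tr z == 0) = (z \in limg (linfun as_map)).
  by rewrite limg_as_map mem_trace_ker mulr1.
case: ifP => [/memv_imgP[y0 _] | z_img]; last first.
  apply/eqP; rewrite cards_eq0; apply/eqP/setP => y; rewrite !inE.
  apply/negP => /eqP yz; move/negP: z_img; apply; apply/memv_imgP.
  by exists y; rewrite ?memvf // lfunE /= /as_map yz.
rewrite lfunE /= => ->.
have c1 := card_finvspace 1; rewrite dimv1 expn1 in c1; rewrite -[RHS]c1.
rewrite -(card_imset _ (addrI (y0 : finvect_type L))); apply: eq_card => y.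
apply/idP/imsetP; rewrite inE.
  move=> yE; exists (y - y0); last by rewrite addrC subrK.
  have : as_map ((y : L) - y0) == 0 by rewrite linearB /= subr_eq0.
  by rewrite inE mem1_exp [as_map _ == 0]subr_eq0.
case=> x; rewrite inE mem1_exp => /eqP xq ->.
have -> : (y0 + x : L) ^+ q - (y0 + x : L) = as_map y0 + as_map x.
  by rewrite -linearD.
by rewrite [as_map x]/as_map xq subrr addr0.
Qed.

Lemma as_npointsE (f : {poly L}) :
  as_npoints q f = (q * #|[set x : finvect_type L | (Tr f.[x] == 0)%R]|).+1.
Proof.
congr _.+1; rewrite -sum1_card.
transitivity (\sum_(x : finvect_type L)
    \sum_(y : finvect_type L | ((y : L) ^+ q - y == f.[x])%R) 1)%N.
  by rewrite pair_big_dep; apply: eq_bigl => P; rewrite inE.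
rewrite -sum1_card big_distrr /= [RHS]big_mkcond /=; apply: eq_bigr => x _.
rewrite sum1_card inE muln1 -(card_as_map_fiber f.[x]); apply: eq_card => y.
by rewrite inE.
Qed.

(** * The polar form and hyperbolic planes *)

Section Form.

Variables (m : nat) (s : nat -> L).
Hypotheses (m_gt0 : (0 < m)%N) (dim_L : N = (2 * m)%N).

Local Notation sx x := (\sum_(i < m) s i * x ^+ (q ^ i)).
Local Notation Q := (fun x : L => Tr (x * sx x)).

(* The coefficients of the polynomial R(z) = sum_k r_k z^(q^k), k < 2 m, with
   polar form Tr(y R(z)): those of S, plus s_i^(q^(-i)) at the exponent -i taken
   modulo 2 m. *)
Definition adjoint_coef k : L :=
  (if (k < m)%N then s k else 0) +
  (if k == 0%N then s 0%N else
   if (m < k)%N then s (2 * m - k)%N ^+ (q ^ k) else 0).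

Local Notation r := adjoint_coef.

Let sxD x y : sx (x + y) = sx x + sx y.
Proof. by rewrite -big_split; apply: eq_bigr => i _; rewrite exprDq mulrDr. Qed.

Let adjoint_sum (z : L) :
  sx z + \sum_(i < m) (s i * z) ^+ (q ^ (2 * m - i)) =
  \sum_(k < N) r k * z ^+ (q ^ k).
Proof.
under [RHS]eq_bigr do rewrite mulrDl; rewrite big_split /=; congr (_ + _).
  rewrite dim_L (big_ord_widen (2 * m) (fun i => s i * z ^+ (q ^ i))).
    rewrite big_mkcond; apply: eq_bigr => i _.
    by case: ifP; rewrite ?mul0r.
  by rewrite mul2n -addnn leq_addr.
pose H k := (if k == 0%N then s 0%N else
   if (m < k)%N then s (2 * m - k)%N ^+ (q ^ k) else 0) * z ^+ (q ^ k).
rewrite -(big_mkord xpredT (fun i => (s i * z) ^+ (q ^ (2 * m - i)))).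
rewrite -(big_mkord xpredT H) dim_L big_ltn // [RHS]big_ltn ?muln_gt0 //.
(* The term i = 0 carries the exponent 2m, which acts as the identity on L and belongs to k = 0; the
   others are reindexed by k = 2m - i. *)
congr (_ + _); first by rewrite subn0 -dim_L exp_card /H /= expr1.
rewrite [RHS](@big_cat_nat _ _ _ m.+1) //=; last by lia.
rewrite [X in _ = X + _](_ : _ = 0) ?add0r; last first.
  rewrite big_nat big1 // => k /andP[k_gt0 lekm].
  by rewrite /H gtn_eqF // ltnNge -ltnS lekm mul0r.
rewrite [RHS]big_nat_rev -[X in _ = \big[_/_]_(X <= _ < _) _]add1n big_addn.
rewrite (_ : 2 * m - m = m)%N; last by lia.
rewrite big_nat [RHS]big_nat; apply: eq_bigr => i /andP[i_gt0 ltim].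
rewrite (_ : 1 + m + 2 * m - (i + m).+1 = 2 * m - i)%N; last by lia.
rewrite /H gtn_eqF; last by lia.
rewrite ifT; last by lia.
by rewrite -exprMn subKn //; lia.
Qed.

Let polarE (x y : L) : polar Q x y = Tr (x * sx y) + Tr (y * sx x).
Proof.
by rewrite /polar sxD mulrDr raddfD /= mulrDl mulrDl !raddfD /=; ring.
Qed.

(** The trace is invariant under the power q^(2m - i), which takes the i-th Frobenius power off y
    and puts its inverse on s_i z. *)
Lemma polar_form (z y : L) :
  polar Q z y = Tr (y * \sum_(k < N) r k * z ^+ (q ^ k)).
Proof.
rewrite polarE addrC -adjoint_sum mulrDr raddfD; congr (_ + _).
rewrite !mulr_sumr !raddf_sum; apply: eq_bigr => i _ /=.
have lei : (i <= 2 * m)%N by rewrite (leq_trans (ltnW (ltn_ord i))) ?leq_pmull.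
rewrite -(galTrace_exp (2 * m - i)) mulrA exprMn -exprM -expnD.
by rewrite subnKC // -dim_L exp_card mulrC (mulrC z).
Qed.

Lemma adjoint_coef_lt k : (0 < k < m)%N -> r k = s k.
Proof.
case/andP=> k_gt0 ltkm; rewrite /r ltkm gtn_eqF // ltnNge ltnW //=.
by rewrite addr0.
Qed.

Lemma adjoint_coef0 : r 0 = 2%:R * s 0%N.
Proof. by rewrite /r m_gt0 eqxx mulr_natl mulr2n. Qed.

Lemma adjoint_coef_mid : r m = 0.
Proof. by rewrite /r ltnn gtn_eqF // addr0. Qed.

Lemma adjoint_coef_gt k : (m < k)%N -> r k = s (2 * m - k)%N ^+ (q ^ k).
Proof.
move=> ltmk; rewrite /r ltnNge (ltnW ltmk) gtn_eqF ?ltmk ?add0r //.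
exact: leq_ltn_trans ltmk.
Qed.

Local Notation R z := (\sum_(k < N) r k * z ^+ (q ^ k)).

Let RD x y : R (x + y) = R x + R y.
Proof. by rewrite -big_split; apply: eq_bigr => i _; rewrite exprDq mulrDr. Qed.

Let RZ (k : Fq) x : R (k *: x) = k *: R x.
Proof.
rewrite scaler_sumr; apply: eq_bigr => i _.
by rewrite exprZn exp_base -scalerAr.
Qed.

Let polarC (x y : L) : polar Q x y = polar Q y x.
Proof. by rewrite !polarE addrC. Qed.

Let polar_diag (x : L) : polar Q x x = Q x + Q x.
Proof. exact: polarE. Qed.

Let sum_coefB (a b z : L) :
  \sum_(k < N) (r k - (a * b ^+ (q ^ k) + b * a ^+ (q ^ k))) * z ^+ (q ^ k) =
  R z - (a * Tr (z * b) + b * Tr (z * a)).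
Proof.
rewrite !galTrace_sum !mulr_sumr -big_split -sumrB; apply: eq_bigr => i _.
by rewrite !exprMn /=; ring.
Qed.

(* A singular vector u outside the radical extends to a hyperbolic pair (u, v),
   and a = R(u), b = R(v) represent the linear forms B(u, _) and B(v, _). *)
Lemma hyperbolic_coefs (W : {vspace L}) (u : L) :
    (forall x, x \in W <-> forall y, polar Q x y = 0) -> (\dim W).+2 = N ->
    Q u = 0 -> u \notin W ->
  exists a b : L, forall k, (k < N)%N ->
    r k = a * b ^+ (q ^ k) + b * a ^+ (q ^ k).
Proof.
move=> W_rad dimW Qu uW; have W_R w : w \in W -> R w = 0.
  move=> /W_rad w_rad; apply: galTrace_nondegenerate => y.
  by rewrite -polar_form w_rad.
have Ru0 : R u != 0.
  apply: contraNneq uW => Ru0; apply/W_rad => y.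
  by rewrite polar_form Ru0 mulr0 raddf0.
have [z1 Trz1] := galTrace_eq1; pose v1 := z1 / R u.
have Buv1 : polar Q u v1 = 1 by rewrite polar_form /v1 divfK.
have [c cE] : exists c : Fq, Q v1 = c%:A by apply/vlineP/galTrace_mem.
(* Subtracting Q(v1) u makes the second vector singular and keeps its pairing with u equal to 1. *)
pose v := v1 - c *: u.
have Buu : polar Q u u = 0 by rewrite polar_diag Qu addr0.
have BrZ k x y : polar Q x (k *: y) = k *: polar Q x y.
  rewrite !polar_form -scalerAl.
  by have := galTrace_linear k (y * R x) 0; rewrite raddf0 !addr0.
have BrD x y z : polar Q x (y + z) = polar Q x y + polar Q x z.
  by rewrite !polar_form mulrDl raddfD.
have Buv : polar Q u v = 1.
  by rewrite /v -scaleNr BrD BrZ Buv1 Buu scaler0 addr0.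
have Qv : Q v = 0.
  have Bvv1 : polar Q v v1 = c%:A.
    rewrite polarC /v -scaleNr BrD BrZ polar_diag cE polarC Buv1 scaleNr.
    by rewrite addrK.
  have /eqP : Q v + Q v = 0.
    by rewrite -polar_diag {2}/v -scaleNr BrD BrZ Bvv1 polarC Buv scaleNr subrr.
  by rewrite -mulr2n -mulr_natl mulf_eq0 (negPf two_neq0) => /eqP.
have Bvv : polar Q v v = 0 by rewrite polar_diag Qv addr0.
clearbody v.
have full_uv : (W + <[u]> + <[v]>)%VS = fullv.
  apply/eqP; rewrite eqEdim subvf -dimW.
  apply: leq_ltn_trans (dim_lt_add_line uW) (dim_lt_add_line _).
  apply/negP => /memv_addP[w wW [_ /vlineP[k ->] vE]].
  have /eqP := Buv; rewrite vE BrD BrZ Buu scaler0 addr0 polarC.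
  by move/W_rad: wW => ->; rewrite eq_sym oner_eq0.
(* The differences of coefficients define the q-polynomial R(z) - (R(u) B(v, z) + R(v) B(u, z)) in
   z; it vanishes on W, u and v, hence identically. *)
exists (R u), (R v) => k ltkN; apply/eqP; rewrite -subr_eq0; apply/eqP.
move: k ltkN; apply: q_poly_eq0 => z.
rewrite -[LHS]/(\sum_(k < N) _) sum_coefB -!polar_form.
have : z \in (W + <[u]> + <[v]>)%VS by rewrite full_uv memvf.
case/memv_addP => _ /memv_addP[w wW [_ /vlineP[k ->] ->]] [_ /vlineP[l ->] ->].
have Bz t : polar Q t (w + k *: u + l *: v) =
    k *: polar Q t u + l *: polar Q t v.
  by rewrite !BrD !BrZ (polarC t w) (iffLR (W_rad w) wW) add0r.
rewrite !RD !RZ W_R // add0r !Bz Buu Bvv (polarC v u) Buv !scaler0 addr0 add0r.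
by rewrite -!scalerAr !mulr1 subrr.
Qed.

Lemma hyperbolic_adjoint (a b z : L) :
    (forall k, (k < N)%N -> r k = a * b ^+ (q ^ k) + b * a ^+ (q ^ k)) ->
  R z = a * Tr (z * b) + b * Tr (z * a).
Proof.
move=> rE; apply/eqP; rewrite -subr_eq0 -sum_coefB big1 // => k _.
by rewrite rE // subrr mul0r.
Qed.

Lemma hyperbolic_form (a b x : L) :
    (forall k, (k < N)%N -> r k = a * b ^+ (q ^ k) + b * a ^+ (q ^ k)) ->
  Q x = Tr (x * a) * Tr (x * b).
Proof.
move=> rE; apply: (mulfI two_neq0).
rewrite mulr_natl mulr2n -polar_diag polar_form (hyperbolic_adjoint _ rE).
rewrite mulrDr raddfD /= !mulrA ![x * _ * Tr _]mulrC.
by rewrite ![Tr (Tr _ * _)]galTraceMl ?galTrace_mem //; ring.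
Qed.

(** Here R(x) = a (Tr(x t a) + t Tr(x a)); both traces lie in F_q and t does not, so R(x) = 0 only
    if both vanish. *)
Lemma hyperbolic_radical (a t : L) : a != 0 -> t != 0 -> t ^+ q = - t ->
    (forall k, (k < N)%N ->
       r k = a * (t * a) ^+ (q ^ k) + t * a * a ^+ (q ^ k)) ->
  forall x, x \in (trace_ker a :&: trace_ker (t * a))%VS <->
    forall y, polar Q x y = 0.
Proof.
move=> a0 t0 tq rE x; rewrite memv_cap !mem_trace_ker; split.
  move=> /andP[/eqP xa /eqP xb] y.
  rewrite polar_form (hyperbolic_adjoint _ rE) xa xb.
  by rewrite !mulr0 addr0 mulr0 raddf0.
move=> x_rad; have /eqP : R x = 0.
  by apply: galTrace_nondegenerate => y; rewrite -polar_form.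
rewrite (hyperbolic_adjoint _ rE) [t * a]mulrC -mulrA -mulrDr.
rewrite mulf_eq0 (negPf a0) /= addr_eq0 => /eqP xtE.
have xa : Tr (x * a) = 0.
  apply/eqP/contraT => xa0; case/negP: (anti_notin1 t0 tq).
  have -> : t = - Tr (x * (a * t)) / Tr (x * a).
    by rewrite xtE opprK mulfK.
  by rewrite memvM ?memvN ?memvV ?galTrace_mem.
by rewrite xtE xa mulr0 oppr0 eqxx.
Qed.

Lemma hyperbolic_coefs_shape (a b : L) :
    (1 < m)%N -> (forall i, (i < m)%N -> s i ^+ (q ^ m) = s i) -> s 0%N != 0 ->
    (forall k, (k < N)%N -> r k = a * b ^+ (q ^ k) + b * a ^+ (q ^ k)) ->
  [/\ (q %% 4 = 3)%N, odd m & forall i : nat, (1 <= i <= m.-1)%N ->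
        (odd i -> s i = 0) /\
        (~~ odd i -> s i = 2 * s 0%N ^+ ((q ^ i + 1) %/ 2)%N)].
Proof.
move=> m_gt1 sE s0 rE.
have ltmN : (m < N)%N by rewrite dim_L; lia.
have s0E : s 0%N = a * b.
  have := rE _ N_gt0; rewrite adjoint_coef0 !expr1 => s0E.
  by apply: (mulfI two_neq0); rewrite s0E; ring.
have /andP[a0 b0] : (a != 0) && (b != 0) by rewrite -negb_or -mulf_eq0 -s0E.
have := rE _ ltmN.
rewrite adjoint_coef_mid => /esym/eqP; rewrite addr_eq0 => /eqP mid.
(* The equation at k = m gives the ratio i for a and -i for b; s_0 = a b being fixed by the power
   q^m gives i^2 = -1, and a^(q^(2m)) = a gives i^(q^m) = -i. *)
have [i aq] : exists i, a ^+ (q ^ m) = i * a.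
  by exists (a ^+ (q ^ m) / a); rewrite divfK.
have bq : b ^+ (q ^ m) = - (i * b) by apply: (mulfI a0); rewrite mid aq; ring.
have i2 : i * i = -1.
  have := sE _ m_gt0; rewrite s0E exprMn aq bq => abE.
  apply: (mulIf (mulf_neq0 a0 b0)); rewrite mulN1r -{2}abE; ring.
have i0 : i != 0.
  by apply: contra_eq_neq i2 => ->; rewrite mul0r eq_sym oppr_eq0 oner_eq0.
have iq : i ^+ (q ^ m) = - i.
  apply: (mulIf i0); apply: (mulIf a0); rewrite mulNr i2 opprK mul1r -mulrA -aq.
  by rewrite -exprMn -aq -exprM -expnD addnn -mul2n -dim_L exp_card.
have i4 : i ^+ 4 = 1 by rewrite (exprM i 2 2) [i ^+ 2]expr2 i2 sqrrN expr1n.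
have qm1 : (q ^ m %% 4 != 1)%N.
  apply/eqP => qm1; have := two_neq0; rewrite -(mulIr_eq0 _ (mulIf i0)).
  by rewrite mulr_natl mulr2n -{1}[i]opprK -iq -(expr_mod _ i4) qm1 addNr eqxx.
have [q3 m_odd] : (q %% 4 = 3)%N /\ odd m.
  have [q1|q3] : (q %% 4 = 1)%N \/ (q %% 4 = 3)%N.
  - have := ltn_pmod q (isT : (0 < 4)%N); have := q_odd.
    rewrite {1}(divn_eq q 4) oddD oddM andbF /=.
    by case: (q %% 4)%N => [|[|[|[|]]]] //; auto.
  - by move: qm1; rewrite -modnXm q1 exp1n.
  split=> //; apply: contraNT qm1 => m_even.
  rewrite -modnXm q3 -[m]even_halfK // -mul2n expnM.
  by rewrite -modnXm exp1n.
have iq1 : i ^+ q = - i.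
  by rewrite -(expr_mod _ i4) q3 exprS expr2 i2 mulrN1.
(* For odd k the power q^m multiplies a b^(q^k) + b a^(q^k) by i^2 = -1, but it fixes s_k. *)
have s_odd k : (0 < k < m)%N -> odd k -> s k = 0.
  move=> ltkm k_odd; have kN : (k < N)%N by case/andP: ltkm => _ /ltn_trans ->.
  have skE := rE _ kN; rewrite adjoint_coef_lt // in skE.
  have ltk : (k < m)%N by case/andP: ltkm.
  have : s k = - s k.
    rewrite -{1}(sE _ ltk) skE exprDq !exprMn -!exprM mulnC !exprM aq bq.
    rewrite exprNq !exprMn (frobenius_anti _ iq1) -signr_odd k_odd.
    have -> x y : i * a * - (((-1) ^+ true * i) * x) +
        - (i * b) * ((-1) ^+ true * i * y) = (i * i) * (a * x + b * y) by ring.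
    by rewrite i2 mulN1r.
  move/eqP; rewrite -addr_eq0 -mulr2n -mulr_natl mulf_eq0 (negPf two_neq0).
  by move/eqP.
split=> // k /andP[k_gt0 lekm].
have ltkm : (k < m)%N by rewrite -(prednK m_gt0) ltnS.
split=> [|k_even]; first by apply: s_odd; rewrite k_gt0.
have [t bE] : exists t, b = t * a by exists (b / a); rewrite divfK.
(* As m > 1, the vanishing of s_1 is available, and it says a b^q = - b a^q. *)
have tq : t ^+ q = - t.
  have s1 : s 1%N = 0 by apply: s_odd.
  have := rE 1%N (ltn_trans m_gt1 ltmN); rewrite adjoint_coef_lt // s1 expn1.
  move/esym/eqP; rewrite addr_eq0 => /eqP e1.
  apply: (mulIf (expf_neq0 q a0)); rewrite -exprMn -bE; apply: (mulfI a0).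
  by rewrite e1 bE; ring.
have t0 : t != 0 by apply: contraNneq b0; rewrite bE => ->; rewrite mul0r.
(* For even k, t^(q^k) = t gives s_k = 2 t a^(q^k + 1), while s_0 = t a^2 and t^((q^k + 1) / 2) =
   t. *)
have := rE k (ltn_trans ltkm ltmN); rewrite adjoint_coef_lt ?k_gt0 // => ->.
rewrite s0E bE !exprMn (frobenius_anti _ tq) -signr_odd (negPf k_even).
rewrite expr0 mul1r (exp_half_anti q3 tq t0 k_even).
have hE : a ^+ ((q ^ k + 1) %/ 2)%N * a ^+ ((q ^ k + 1) %/ 2)%N =
    a * a ^+ (q ^ k).
  rewrite -expr2 -exprM -exprS; congr (_ ^+ _); rewrite divnK ?addn1 //.
  by rewrite dvdn2 /= oddX q_odd orbT.
by rewrite [_ * (t * a ^+ ((_ + 1) %/ 2)%N)]mulrCA hE; ring.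
Qed.

End Form.

(** Euler's criterion: writing x = g^i for a generator g of the cyclic group of units, the
    hypothesis makes i even. *)
Lemma sqrt_exists (x : L) :
  x != 0 -> x ^+ ((q ^ N).-1 %/ 2)%N = 1 -> exists a : L, a * a = x.
Proof.
move=> x0 xh; pose Q := (q ^ N).-1.
have qN_gt1 : (1 < q ^ N)%N by rewrite -(exp1n N) ltn_exp2r.
have Q_gt0 : (0 < Q)%N by rewrite -ltnS prednK // ltnW.
have Q2 : (2 %| Q)%N.
  by rewrite dvdn2 -[odd Q]negbK -oddS prednK ?(ltnW qN_gt1) // oddX q_odd orbT.
have unity y : y != 0 :> L -> y ^+ Q = 1.
  move=> y0; apply: (mulIf y0).
  by rewrite -exprSr prednK ?exp_card ?mul1r // ltnW.
pose rs := [seq y <- enum (finvect_type L) | y != 0] : seq L.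
have [] := @hasP _ Q.-primitive_root rs _.
  apply: has_prim_root => //.
  - apply/allP => y; rewrite mem_filter => /andP[y0 _].
    exact/unity_rootP/unity.
  - exact: filter_uniq (enum_uniq (finvect_type L)).
  have := count_predC (pred1 (0 : finvect_type L)) (enum (finvect_type L)).
  rewrite -cardE card_finvect (count_uniq_mem _ (enum_uniq _)) mem_enum => cnt.
  by rewrite size_filter /Q -cnt.
move=> g _ g_prim; have [[i ltiQ] xE] := prim_rootP g_prim (unity x x0).
have : (2 %| i)%N.
  move: xh; rewrite xE -exprM => /eqP; rewrite -(prim_order_dvd g_prim).
  rewrite -[Q in (Q %| _)%N](divnK Q2) -/Q mulnC dvdn_pmul2r //.
  by rewrite divn_gt0 // dvdn_leq.
by move=> /dvdnP[j jE]; exists (g ^+ j); rewrite xE -exprD addnn -muln2 /= jE.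
Qed.

(** * From the coefficient formula to a hyperbolic form *)

Section Converse.

Variables (m : nat) (s : nat -> L).
Hypotheses (m_gt1 : (1 < m)%N) (dim_L : N = (2 * m)%N).
Hypotheses (sE : forall i, (i < m)%N -> s i ^+ (q ^ m) = s i).
Hypotheses (s0 : s 0%N != 0) (q3 : (q %% 4 = 3)%N) (m_odd : odd m).
Hypothesis s_shape : forall i : nat, (1 <= i <= m.-1)%N ->
        (odd i -> s i = 0) /\
        (~~ odd i -> s i = 2 * s 0%N ^+ ((q ^ i + 1) %/ 2)%N).

Lemma shape_hyperbolic_coefs : exists a t : L,
  [/\ a != 0, t != 0, t ^+ q = - t & forall k, (k < N)%N ->
    adjoint_coef m s k = a * (t * a) ^+ (q ^ k) + t * a * a ^+ (q ^ k)].
Proof.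
have m_gt0 := ltnW m_gt1.
pose h := ((q ^ N).-1 %/ 2)%N.
(* For q = 3 mod 4, 8 divides q^2 - 1 and hence q^N - 1, so fourth roots of unity pass Euler's
   criterion. *)
have [c hE] : exists c, h = (4 * c)%N.
  have [d dE] : exists d, ((q ^ 2).-1 = 8 * d)%N.
    exists ((q %/ 4).*2.+1 * (q %/ 4).+1)%N.
    by rewrite {1}(divn_eq q 4) q3 -mul2n; lia.
  have /dvdnP[j jE] := dvdn_pred_predX (q ^ 2) m.
  exists (j * d)%N; rewrite /h dim_L expnM jE dE.
  have -> : (j * (8 * d) = 4 * (j * d) * 2)%N by lia.
  by rewrite mulnK.
have [t tt] : exists t : L, t * t = -1.
  apply: sqrt_exists; first by rewrite oppr_eq0 oner_eq0.
  by rewrite -/h hE exprM -signr_odd expr1n.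
have t4 : t ^+ 4 = 1 by rewrite (exprM t 2 2) [t ^+ 2]expr2 tt sqrrN expr1n.
have t0 : t != 0.
  by apply: contra_eq_neq tt => ->; rewrite mul0r eq_sym oppr_eq0 oner_eq0.
have tq : t ^+ q = - t by rewrite -(expr_mod _ t4) q3 exprS expr2 tt mulrN1.
(* The choice a^2 = s_0 / t makes s_0 = a (t a). The quotient is a square: t^h = 1 as 4 divides h,
   and s_0^h = 1 as q^m - 1 divides h and s_0 is fixed by the power q^m. *)
have [a aa] : exists a : L, a * a = s 0%N / t.
  apply: sqrt_exists; first by rewrite mulf_neq0 ?invr_eq0.
  rewrite -/h exprMn exprVn [t ^+ h](_ : _ = 1) ?invr1 ?mulr1; last first.
    by rewrite hE exprM t4 expr1n.
  have s0q : s 0%N ^+ (q ^ m).-1 = 1.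
    apply: (mulIf s0); rewrite -exprSr prednK ?expn_gt0 ?q_gt0 // sE //.
    by rewrite mul1r.
  have -> : h = ((q ^ m).-1 * ((q ^ m).+1 %/ 2))%N.
    rewrite /h muln_divA; last by rewrite dvdn2 /= oddX q_odd orbT.
    rewrite dim_L mulnC expnM; congr (_ %/ _)%N.
    by case: (q ^ m)%N => // u; lia.
  by rewrite exprM s0q expr1n.
have s0E : s 0%N = a * (t * a) by rewrite mulrCA aa mulrC divfK.
have a0 : a != 0 by apply: contraNneq s0; rewrite s0E => ->; rewrite mul0r.
exists a, t; split=> //.
have low k : (0 < k < m)%N ->
    s k = a * (t * a) ^+ (q ^ k) + t * a * a ^+ (q ^ k).
  case/andP=> k_gt0 ltkm.
  have [|s_odd s_even] := s_shape (i := k); first by rewrite k_gt0 -ltnS prednK.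
  rewrite exprMn (frobenius_anti _ tq) -signr_odd.
  have [k_odd|k_even] := boolP (odd k); first by rewrite s_odd //; ring.
  rewrite s_even // s0E !exprMn (exp_half_anti q3 tq t0 k_even) expr0 mul1r.
  have hk : a ^+ ((q ^ k + 1) %/ 2)%N * a ^+ ((q ^ k + 1) %/ 2)%N =
      a * a ^+ (q ^ k).
    rewrite -expr2 -exprM -exprS; congr (_ ^+ _); rewrite divnK ?addn1 //.
    by rewrite dvdn2 /= oddX q_odd orbT.
  by rewrite [_ * (t * a ^+ ((_ + 1) %/ 2)%N)]mulrCA hk; ring.
move=> k ltkN; case: (posnP k) => [->|k_gt0].
  by rewrite adjoint_coef0 // s0E !expr1; ring.
(* For k > m, the formula at 2m - k raised to the power q^k is the one at k with its two terms
   exchanged; at k = m the two terms cancel because m is odd. *)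
case: (ltngtP k m) => [ltkm|ltmk|->].
- by rewrite adjoint_coef_lt ?k_gt0 // low ?k_gt0.
- rewrite adjoint_coef_gt // low; last by move: ltkN; rewrite dim_L; lia.
  rewrite exprDq 2!(exprMn (q ^ k)) -!exprM -!expnD subnK; last first.
    by rewrite ltnW // -dim_L.
  by rewrite -dim_L !exp_card; ring.
rewrite adjoint_coef_mid // exprMn (frobenius_anti _ tq) -signr_odd m_odd; ring.
Qed.

End Converse.

End TraceForm.

(** * Maximality as a count of zeros, and the equivalence *)

Lemma size_linearized (R : idomainType) (q m : nat) (s : nat -> R) :
    (1 < q)%N -> (0 < m)%N -> s m.-1 != 0 ->
  size ('X * \sum_(i < m) s i *: 'X^(q ^ i)) = (q ^ m.-1).+2.
Proof.
move=> q_gt1; case: m => // m _ /= sm0.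
have szS : size (\sum_(i < m.+1) s i *: 'X^(q ^ i)) = (q ^ m).+1.
  rewrite big_ord_recr /= addrC size_polyDl size_scale ?size_polyXn // ltnS.
  rewrite (leq_trans (size_sum _ _ _)) //; apply/bigmax_leqP => i _.
  by rewrite (leq_trans (size_scale_leq _ _)) // size_polyXn ltn_exp2l.
by rewrite mulrC size_mulX ?szS // -size_poly_eq0 szS.
Qed.

(** With degree n = q^(m-1) + 1 the genus satisfies 2 g = q^(m-1) (q - 1), and the square root of
    q^(2m) is q^m, so maximality becomes an equation between natural numbers. *)
Lemma as_maximalE (p e q m : nat) (Fq : finFieldType)
    (L : splittingFieldType Fq) (f : {poly L}) (X : as_curve q f) :
    prime p -> odd p -> (0 < e)%N -> q = (p ^ e)%N -> #|Fq| = q ->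
    (1 < m)%N -> \dim {:L} = (2 * m)%N -> size f = (q ^ m.-1).+2 ->
  as_maximal X <->
  (q * #|[set x : finvect_type L | (galTrace 1 {:L} f.[x] == 0)%R]|
     = q ^ (2 * m) + q ^ m.-1 * q.-1 * q ^ m)%N.
Proof.
move=> p_pr p_odd e_gt0 q_def card_Fq m_gt1 dim_L szf.
have pcharL : p \in [pchar L].
  apply/(rmorph_pchar (in_alg L))/(card_finPcharP (n := e)) => //.
  by rewrite card_Fq.
have q_odd : odd q by rewrite q_def oddX p_odd orbT.
have co_p : coprime (q ^ m.-1).+1 p.
  rewrite coprime_sym prime_coprime // -addn1.
  rewrite dvdn_addr ?dvdn1 ?gtn_eqF ?prime_gt1 //.
  by rewrite dvdn_exp // ?q_def ?dvdn_exp //; lia.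
have genusE g :=
  artin_schreier_genus X pcharL e_gt0 q_def szf (ltn0Sn _) co_p g.
have cardL : #|finvect_type L| = (q ^ (2 * m))%N.
  by rewrite (card_finvect L card_Fq) dim_L.
have sqrtL : sqrtC (#|finvect_type L|%:R : algC) = (q ^ m)%:R.
  by rewrite cardL mulnC expnM natrX sqrCK ?ler0n.
rewrite /as_maximal sqrtL (as_npointsE p_pr e_gt0 q_def card_Fq) cardL.
split=> [[g /genusE /= g2] | eqZ].
  rewrite -mulrA -!natrM natr1 -natrD => /eqP.
  rewrite eqr_nat => /eqP; rewrite addSn => -[->].
  by rewrite mulnA (mul2n g) g2.
have half_g : ((q ^ m.-1 * q.-1)./2.*2 = q ^ m.-1 * q.-1)%N.
  have q_gt0 : (0 < q)%N by rewrite odd_gt0.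
  by rewrite even_halfK // oddM negb_and -(oddS q.-1) prednK // q_odd orbT.
exists (q ^ m.-1 * q.-1)./2; first by apply/genusE; rewrite half_g.
by rewrite -mulrA -!natrM natr1 -natrD eqZ addSn mulnA (mul2n _./2) half_g.
Qed.

Theorem corollary1 (p e q m : nat)
    (p_prime : prime p) (p_odd : odd p) (e_gt0 : (0 < e)%N)
    (q_def : q = (p ^ e)%N) (m_ge2 : (2 <= m)%N)
    (Fq : finFieldType) (card_Fq : #|Fq| = q)
    (L : splittingFieldType Fq) (dim_L : \dim {:L} = (2 * m)%N)
    (E : {subfield L}) (dim_E : \dim E = m)
    (s : nat -> L) (s_E : forall i, (i < m)%N -> s i \in E)
    (s_neq0 : s 0%N * s m.-1 != 0)
    (S : {poly L}) (S_def : S = \sum_(i < m) s i *: 'X^(q ^ i))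
    (X : as_curve q ('X * S)) :
  (radical_dim (fun x : L => galTrace 1 {:L} (x * S.[x])) (2 * m - 2)
     /\ as_maximal X)
  <->
  [/\ q = 3 %[mod 4], odd m, s 0%N \in E /\ s 0%N != 0
    & forall i : nat, (1 <= i <= m.-1)%N ->
        (odd i -> s i = 0) /\
        (~~ odd i -> s i = 2 * s 0%N ^+ ((q ^ i + 1) %/ 2))].
Proof.
move: s_neq0; rewrite mulf_eq0 negb_or => /andP[s0 sm].
have m_gt0 : (0 < m)%N := ltnW m_ge2.
have q_gt1 : (1 < q)%N by rewrite q_def -(exp1n e) ltn_exp2r // prime_gt1.
have q_gt0 := ltnW q_gt1.
have sE i : (i < m)%N -> s i ^+ (q ^ m) = s i.
  by move=> /s_E; rewrite (mem_subfield_exp card_Fq) dim_E => /eqP.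
have SE x : S.[x] = \sum_(i < m) s i * x ^+ (q ^ i).
  rewrite S_def horner_sum; apply: eq_bigr => i _.
  by rewrite hornerZ hornerXn.
have polE x y : polar (fun x : L => galTrace 1 {:L} (x * S.[x])) x y =
    polar (fun x : L => galTrace 1 {:L}
                          (x * \sum_(i < m) s i * x ^+ (q ^ i))) x y.
  by rewrite /polar !SE.
have szf : size ('X * S) = (q ^ m.-1).+2 by rewrite S_def size_linearized.
rewrite (as_maximalE X p_prime p_odd e_gt0 q_def card_Fq m_ge2 dim_L szf).
set Z := [set x | _].
have ZE x : (x \in Z) =
    (galTrace 1 {:L} (x * \sum_(i < m) s i * (x : L) ^+ (q ^ i)) == 0).
  by rewrite inE hornerM hornerX SE.
have qNE : (q ^ (2 * m) = q * (q * q ^ (2 * m).-2))%N.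
  by rewrite -!expnS; congr (q ^ _)%N; lia.
split=> [[[W W_rad dimW] cardZ] | [q3 m_odd _ s_shape]].
  have dimW2 : (\dim W).+2 = \dim {:L} by rewrite dim_L dimW; lia.
  (* Maximality gives at least q^(2m - 1) zeros, more than the q^(2m - 2) elements of the
     radical. *)
  have [u uZ uW] : exists2 u : L, u \in Z & u \notin W.
    pose Ws := [set x : finvect_type L | (x : L) \in W].
    suff /subsetPn[u uZ] : ~~ (Z \subset Ws) by rewrite inE; exists u.
    apply/negP => /subset_leq_card.
    rewrite (card_finvspace card_Fq) -[\dim W]/((\dim W).+2.-2).
    rewrite dimW2 dim_L => leZ.
    have : (q * (q * q ^ (2 * m).-2) <= q * q ^ (2 * m).-2)%N.
      apply: leq_trans (_ : q * #|Z| <= _)%N.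
        by rewrite cardZ qNE leq_addr.
      by rewrite leq_mul2l leZ orbT.
    rewrite leq_pmul2l // -{2}[(q ^ _)%N]mul1n.
    by rewrite leq_pmul2r ?expn_gt0 ?q_gt0 // leqNgt q_gt1.
  have W_rad' x : x \in W <-> forall y, polar (fun x : L => galTrace 1 {:L}
      (x * \sum_(i < m) s i * x ^+ (q ^ i))) x y = 0.
    by rewrite W_rad; split=> rad y; [rewrite -polE | rewrite polE].
  have Qu : galTrace 1 {:L} (u * \sum_(i < m) s i * u ^+ (q ^ i)) = 0.
    by apply/eqP; rewrite -ZE.
  have [a [b abE]] := hyperbolic_coefs p_prime p_odd e_gt0 q_def card_Fq
    m_gt0 dim_L W_rad' dimW2 Qu uW.
  have [q3 m_odd s_shape] := hyperbolic_coefs_shape p_prime p_odd e_gt0 q_def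
    card_Fq m_gt0 dim_L m_ge2 sE s0 abE.
  by split=> //; split=> //; apply: s_E.
have [a [t [a0 t0 tq atE]]] := shape_hyperbolic_coefs p_prime p_odd e_gt0 q_def
  card_Fq m_ge2 dim_L sE s0 q3 m_odd s_shape.
split.
  exists (trace_ker a :&: trace_ker (t * a))%VS.
    move=> x; rewrite (hyperbolic_radical p_prime p_odd e_gt0 q_def card_Fq
      m_gt0 dim_L a0 t0 tq atE).
    by split=> rad y; [rewrite polE | rewrite -polE].
  have := dim_cap_trace_ker p_prime p_odd e_gt0 q_def card_Fq a0 t0 tq.
  by rewrite dim_L => <-; lia.
have := card_zeros p_prime p_odd e_gt0 q_def card_Fq a0 t0 tq.
rewrite (_ : #|_| = #|Z|); last first.
  apply: eq_card => x; rewrite ZE inE.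
  by rewrite (hyperbolic_form p_prime p_odd e_gt0 q_def card_Fq m_gt0
    dim_L _ atE).
rewrite dim_L => cardZ.
(* Both counts reduce to q #|Z| = 2 q^(2m) - q^(2m - 1). *)
have qmE : (q ^ m.-1 * q ^ m = q * q ^ (2 * m).-2)%N.
  by rewrite -expnD -expnS; congr (q ^ _)%N; lia.
have qN1 : (q ^ (2 * m).-1 = q * q ^ (2 * m).-2)%N.
  by rewrite -expnS; congr (q ^ _)%N; lia.
rewrite mulnAC qmE qNE; rewrite qN1 in cardZ.
move: cardZ q_gt0; move: #|Z| (q ^ _)%N => u v; clear; case: q => //= r; nia.
Qed.
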